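(* Let $0<c<\sqrt{2}$, let $\lambda_0>0$, and let $\phi$ be the traveling wave profile obtained as a constrained maximizer as described in the context. Then $\phi$ and all its derivatives satisfy the exponential bound: for every $j=0,1,2,\ldots$ there is a constant $C_j$ such that $$|\phi^{(j)}(x)|\le C_j\,e^{-\frac{\sqrt{2-c^2}}{2}|x|},\qquad x\in\mathbb{R}.$$
   Context: $F(r)=\sum_{k=1}^N a_kr^k$ is a polynomial with $a_k\ge0$, not all zero, and $G(r)=\sum_{k=1}^N\frac{a_k}{k+1}r^{k+1}$, so $G'=F$. For real-valued $u\in H^2(\mathbb{R})$ put $$I[u]=\int_{\mathbb{R}}G(|u|^2)\,dx,\qquad L[u]=\int_{\mathbb{R}}(u'')^2-c^2(u')^2+u^2\,dx.$$ The wave: $\phi\in H^2(\mathbb{R})$ is a real-valued maximizer of $I[u]$ subject to the constraint $L[u]=\lambda_0$, and $\gamma=\kappa^{-1}$ with $\kappa=\frac{1}{\lambda_0}\int_{\mathbb{R}}F(\phi^2)\phi^2\,dx$. Then $\phi\in H^\infty(\mathbb{R})=\bigcap_{j\ge 0}H^j(\mathbb{R})$ solves $\phi_{xxxx}+c^2\phi_{xx}+\phi-\gamma F(\phi^2)\phi=0$ on $\mathbb{R}$. *)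

(* Defs.v *)
From HB Require Import structures.
From mathcomp Require Import all_boot all_order all_algebra.
From mathcomp Require Import all_classical all_reals all_analysis.

Set Implicit Arguments.
Unset Strict Implicit.
Unset Printing Implicit Defensive.

Import Order.TTheory GRing.Theory Num.Theory.
Import numFieldNormedType.Exports.

Local Open Scope classical_set_scope.
Local Open Scope ring_scope.

Definition smooth (R : realType) (f : R -> R) : Prop :=
  forall (n : nat) (x : R), derivable (derive1n n f) x 1.

Definition test_function (R : realType) (eta : R -> R) : Prop :=
  smooth eta /\ compact (closure [set x | eta x != 0]).

Definition in_L2 (R : realType) (u : R -> R) : Prop :=
  u \in Lfun (@lebesgue_measure R) 2%:E.

(* v is a weak derivative of order j of u, both being square integrable. *)
Definition is_weak_derivative (R : realType) (j : nat) (u v : R -> R) : Prop :=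
  [/\ in_L2 u, in_L2 v &
    forall eta : R -> R, test_function eta ->
      \int[@lebesgue_measure R]_x (u x * derive1n j eta x) =
      (-1) ^+ j * \int[@lebesgue_measure R]_x (v x * eta x)].

(* Elements of H^m are represented by functions; two functions that agree
   almost everywhere represent the same element. *)
Definition in_H (R : realType) (m : nat) (u : R -> R) : Prop :=
  forall j : nat, (j <= m)%N -> exists v : R -> R, is_weak_derivative j u v.

(* The weak derivative is unique only up to a.e. equality; an arbitrary
   representative is chosen, and the integrals below do not depend on it.
   The value 0 is used when there is no weak derivative in L^2. *)
Definition weak_derivative (R : realType) (j : nat) (u : R -> R) : R -> R :=
  xget (cst 0) [set v : R -> R | is_weak_derivative j u v].

(* The primitive, vanishing at 0, of F(r) = \sum_(1 <= k <= N) a_k r^k; the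
   coefficient a 0 plays no role. *)
Definition G (R : realType) (N : nat) (a : nat -> R) (r : R) : R :=
  \sum_(1 <= k < N.+1) a k / k.+1%:R * r ^+ k.+1.

Definition I_functional (R : realType) (N : nat) (a : nat -> R)
    (u : R -> R) : R :=
  \int[@lebesgue_measure R]_x G N a (`|u x| ^+ 2).

Definition L_functional (R : realType) (c : R) (u : R -> R) : R :=
  \int[@lebesgue_measure R]_x
    (weak_derivative 2 u x ^+ 2 - c ^+ 2 * weak_derivative 1 u x ^+ 2
     + u x ^+ 2).

Definition constrained_maximizer (R : realType) (N : nat) (a : nat -> R)
    (c lambda0 : R) (phi : R -> R) : Prop :=
  [/\ in_H 2 phi, L_functional c phi = lambda0 &
    forall u : R -> R, in_H 2 u -> L_functional c u = lambda0 ->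
      I_functional N a u <= I_functional N a phi].

(* Main.v *)
Require Import Defs.
From HB Require Import structures.
From mathcomp Require Import all_boot all_order all_algebra.
From mathcomp Require Import all_classical all_reals all_analysis.
From mathcomp Require Import measurable_realfun.
From mathcomp Require Import ring lra.
Import Order.TTheory GRing.Theory Num.Theory.
Import numFieldNormedType.Exports.
Local Open Scope classical_set_scope.
Local Open Scope ring_scope.

Set Implicit Arguments.
Unset Strict Implicit.
Unset Printing Implicit Defensive.

(** Write F(r) for the sum of the a_k r^k, f = F(psi^2) psi, and
    al = sqrt(2 - c^2) / 2, where psi is a continuously differentiable
    representative of the maximizer phi; let K be the integral of f psi.

    The maximizer is a weak solution.  Since the coefficients are nonnegative,
    r |-> G(r^2) is convex, so the functional I lies above its tangent at psi
    ([I_functional_tangent]); hence the integral of f (u - psi) is at most 0 for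
    every competitor u.  As L is a quadratic form, psi + t eta can be rescaled
    to satisfy the constraint, and letting t tend to 0 from both sides gives the
    Euler-Lagrange equation without differentiating I ([lagrange_multiplier],
    [euler_lagrange]).

    Weak solutions are classical.  Testing a weak identity against smooth
    approximations of combinations of point masses, placed at Lebesgue points,
    shows that a function with a weak derivative h is a primitive of h
    ([primitive_of_weak_derivative]), and that a function whose second weak
    derivative vanishes is affine ([affine_of_weak]).  The first fact gives psi,
    which moreover is bounded and tends to 0 at infinity ([H1_vanishing]); the
    second one, applied to psi'' + c^2 psi + (double primitive of psi - g) with
    g = (lambda0 / K) f, turns the weak equation into
    psi'''' + c^2 psi'' + psi = g ([weak_solution_regular]).

    The rate is that of the linear equation.  With D the derivative,
      D^4 + c^2 D^2 + 1 = (D^2 + 2 al D + 1) (D^2 - 2 al D + 1),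
    so z = psi'' - 2 al psi' + psi is a damped oscillator driven by g, and psi is
    an oscillator with negative damping driven by z.  Each one has an energy
    that evolves at the rate -2 al, resp. 2 al, up to its forcing.  A bounded
    solution cannot follow the growing direction, so the energy of psi is
    controlled by that of z.  Because g = O(psi^3) is negligible against psi near
    infinity, this yields the decay of psi at half the rate al; then g decays at
    the rate 3 al / 2, which exceeds al, and a second pass yields the rate al
    exactly ([psi_sqr_decay], [stable_energy_decay], [unstable_energy_decay]).
    The equation is invariant under x |-> - x, which settles the other half-line
    ([decay]).

    The bounds on psi, psi', psi'', psi''' propagate to all derivatives by
    differentiating the equation, since functions decaying exponentially with
    all their derivatives form an algebra ([regular_decay_bootstrap]). *)

(** * Derivatives and classes of regularity *)

Section Calculus.
Context {R : realType}.
Implicit Types f g df dg : R -> R.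

Definition has_derivative f df := forall x : R, is_derive x 1 f (df x).

Lemma has_derivative_ext f df dg :
  has_derivative f df -> df =1 dg -> has_derivative f dg.
Proof. by move=> h e x; rewrite -e. Qed.

Lemma has_derivativeE f df : has_derivative f df -> (derive1 f) = df.
Proof. by move=> h; apply/funext => x; rewrite derive1E; exact: derive_val. Qed.

Lemma has_derivative_continuous f df : has_derivative f df -> continuous f.
Proof.
move=> h x; apply: differentiable_continuous; apply/derivable1_diffP.
exact: ex_derive.
Qed.

Lemma has_derivative_cst (k : R) : has_derivative (fun=> k) (fun=> 0).
Proof. by move=> x; exact: is_derive_cst. Qed.

Lemma has_derivative_id : has_derivative id (fun=> 1).
Proof. by move=> x; exact: is_derive_id. Qed.

Lemma has_derivativeD f g df dg : has_derivative f df -> has_derivative g dg ->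
  has_derivative (fun x => f x + g x) (fun x => df x + dg x).
Proof. by move=> hf hg x; exact: is_deriveD. Qed.

Lemma has_derivativeZ f df k : has_derivative f df ->
  has_derivative (fun x => k * f x) (fun x => k * df x).
Proof. by move=> hf x; exact: is_deriveZ. Qed.

Lemma has_derivativeB f g df dg : has_derivative f df -> has_derivative g dg ->
  has_derivative (fun x => f x - g x) (fun x => df x - dg x).
Proof. by move=> hf hg x; exact: is_deriveB. Qed.

Lemma has_derivativeM f g df dg : has_derivative f df -> has_derivative g dg ->
  has_derivative (fun x => f x * g x) (fun x => df x * g x + f x * dg x).
Proof.
move=> hf hg x; have := is_deriveM (hf x) (hg x) => /is_derive_eq; apply.
by rewrite /GRing.scale/= addrC [g x * _]mulrC.
Qed.

Lemma has_derivative_sqr f df : has_derivative f df ->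
  has_derivative (fun x => f x ^+ 2) (fun x => 2 * f x * df x).
Proof.
move=> hf; apply: has_derivative_ext (has_derivativeM hf hf) _ => x /=.
by ring.
Qed.

Lemma has_derivative_affine f df k b : has_derivative f df ->
  has_derivative (fun x => f (k * x + b)) (fun x => k * df (k * x + b)).
Proof.
move=> hf x.
have hg : has_derivative (fun x => k * x + b) (fun=> k * 1 + 0).
  exact: (has_derivativeD (has_derivativeZ _ has_derivative_id)
    (has_derivative_cst _)).
have := @is_derive1_comp R f (fun x => k * x + b) x _ _ (hf _) (hg x).
move=> /is_derive_eq; apply.
by rewrite addr0 mulr1 mulrC.
Qed.

Lemma has_derivative_reflect f df : has_derivative f df ->
  has_derivative (fun x => f (- x)) (fun x => - df (- x)).
Proof.
move=> hf x; have := has_derivative_affine (- 1) 0 hf x.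
rewrite mulN1r addr0 mulN1r; under eq_fun do rewrite mulN1r addr0; exact.
Qed.

Lemma has_derivative_expR k :
  has_derivative (fun x => expR (k * x)) (fun x => k * expR (k * x)).
Proof.
have h : has_derivative expR (@expR R) by move=> y; exact: is_derive_expR.
move=> x; have := has_derivative_affine k 0 h x.
by rewrite addr0; under eq_fun do rewrite addr0.
Qed.

Lemma has_derivative_MVT f df a b : has_derivative f df -> a <= b ->
  exists2 c, a <= c <= b & f b - f a = df c * (b - a).
Proof.
move=> hf ab; have [c] := @MVT_segment R f df a b ab (fun t _ => hf t)
  (continuous_subspaceT (has_derivative_continuous hf)).
by rewrite in_itv/=; exists c.
Qed.

Lemma constant_of_derivative f df a b : has_derivative f df -> a <= b ->
  (forall t, a <= t <= b -> df t = 0) -> f b = f a.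
Proof.
move=> hf ab h; have [c /h dc e] := has_derivative_MVT hf ab.
by apply/eqP; rewrite -subr_eq0 e dc mul0r.
Qed.

Lemma has_derivative_nondecreasing f df (X x y : R) : has_derivative f df ->
  (forall t, X <= t -> 0 <= df t) -> X <= x -> x <= y -> f x <= f y.
Proof.
move=> hf h0 Xx xy.
have [c /andP[xc _] e] := has_derivative_MVT hf xy.
rewrite -subr_ge0 e mulr_ge0 ?subr_ge0// h0//.
exact: le_trans xc.
Qed.

Lemma has_derivative_nonincreasing f df (X x y : R) : has_derivative f df ->
  (forall t, X <= t -> df t <= 0) -> X <= x -> x <= y -> f y <= f x.
Proof.
move=> hf h0 Xx xy; rewrite -lerN2 -(mulN1r (f x)) -(mulN1r (f y)).
apply: (@has_derivative_nondecreasing (fun x => - 1 * f x)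
   (fun x => - 1 * df x) X x y) => //.
- exact: has_derivativeZ.
by move=> t /h0 h; rewrite mulN1r oppr_ge0.
Qed.

(** [B] is a bound imposed on the function and its derivatives up to
    order [n]: the constant [True] yields plain n-fold differentiability, and
    exponential decay yields the class in which the profile is finally placed.
    Both share the closure properties proved here. *)
Fixpoint regular (B : (R -> R) -> Prop) (n : nat) f : Prop :=
  B f /\ if n is m.+1 then exists2 df, has_derivative f df & regular B m df
         else True.

Section RegularClosure.
Variable B : (R -> R) -> Prop.
Hypothesis BD : forall f g, B f -> B g -> B (fun x => f x + g x).
Hypothesis BZ : forall k f, B f -> B (fun x => k * f x).
Hypothesis BM : forall f g, B f -> B g -> B (fun x => f x * g x).

Lemma regular_base n f : regular B n f -> B f.
Proof. by case: n => [|n] []. Qed.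

Lemma regularW n f : regular B n.+1 f -> regular B n f.
Proof.
elim: n f => [|n IH] f [Bf [df hf rf]]; first by split.
by split=> //; exists df => //; exact: IH.
Qed.

Lemma regularD n f g : regular B n f -> regular B n g ->
  regular B n (fun x => f x + g x).
Proof.
elim: n f g => [|n IH] f g [Bf hf] [Bg hg]; split=> //; try exact: BD.
case: hf hg => df hf rf [dg hg rg].
exists (fun x => df x + dg x); first exact: has_derivativeD.
exact: IH.
Qed.

Lemma regularZ n k f : regular B n f -> regular B n (fun x => k * f x).
Proof.
elim: n f => [|n IH] f [Bf hf]; split=> //; try exact: BZ.
case: hf => df hf rf.
exists (fun x => k * df x); first exact: has_derivativeZ.
exact: IH.
Qed.

(** The product rule turns [f] and [g] themselves into factors of the
    derivative, hence the use of [regularW] on them. *)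
Lemma regularM n f g : regular B n f -> regular B n g ->
  regular B n (fun x => f x * g x).
Proof.
elim: n f g => [|n IH] f g rf rg.
  by split=> //; apply: BM; [exact: regular_base rf|exact: regular_base rg].
have := regularW rf; have := regularW rg.
case: rf rg => Bf [df hf rf] [Bg [dg hg rg]] rg' rf'.
split; first exact: BM.
exists (fun x => df x * g x + f x * dg x); first exact: has_derivativeM.
by apply: regularD; exact: IH.
Qed.

End RegularClosure.

Lemma regular_derive1n B n m f : regular B (n + m) f ->
  regular B m (derive1n n f).
Proof.
elim: n m f => [//|n IH] m f; rewrite addSnnS => /IH[_ [df hf rf]].
by rewrite derive1nS (has_derivativeE hf).
Qed.

Lemma regular_derivable B n f : regular B n.+1 f ->
  forall x : R, derivable (derive1n n f) x 1.
Proof.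
rewrite -addn1 => /regular_derive1n[_ [df hf _]] x.
exact: ex_derive.
Qed.

Lemma regular_smooth B f : (forall n, regular B n f) -> smooth f.
Proof. by move=> h n; exact: regular_derivable. Qed.

Lemma smooth_has_derivative f : smooth f -> has_derivative f (derive1 f).
Proof. by move=> sf x; rewrite derive1E; apply: DeriveDef => //; exact: (sf 0%N). Qed.

Lemma derive1nSr n f : derive1n n.+1 f = derive1n n (derive1 f).
Proof. by rewrite /derive1n iterSr. Qed.

Lemma smooth_derive1 f : smooth f -> smooth (derive1 f).
Proof. by move=> sf n; rewrite -derive1nSr; exact: sf. Qed.

Lemma smooth_regular n f : smooth f -> regular (fun=> True) n f.
Proof.
elim: n f => [|n IH] f sf; split => //.
by exists (derive1 f); [exact: smooth_has_derivative|apply: IH; exact: smooth_derive1].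
Qed.

Lemma has_derivative_smooth f df : has_derivative f df -> smooth df -> smooth f.
Proof.
move=> hf sdf [|n] x; first exact: ex_derive.
by rewrite derive1nSr (has_derivativeE hf).
Qed.

Lemma smoothD f g : smooth f -> smooth g -> smooth (fun x => f x + g x).
Proof.
by move=> sf sg; apply: (@regular_smooth (fun=> True)) => n;
  apply: regularD => //; exact: smooth_regular.
Qed.

Lemma smoothZ k f : smooth f -> smooth (fun x => k * f x).
Proof.
by move=> sf; apply: (@regular_smooth (fun=> True)) => n;
  apply: regularZ => //; exact: smooth_regular.
Qed.

Lemma smoothM f g : smooth f -> smooth g -> smooth (fun x => f x * g x).
Proof.
by move=> sf sg; apply: (@regular_smooth (fun=> True)) => n;
  apply: regularM => //; exact: smooth_regular.
Qed.

Lemma smooth_affine f k b : smooth f -> smooth (fun x => f (k * x + b)).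
Proof.
move=> sf; apply: (@regular_smooth (fun=> True)) => n.
elim: n f sf => [|n IH] f sf; split => //.
exists (fun x => k * (derive1 f) (k * x + b)).
  exact/has_derivative_affine/smooth_has_derivative.
by apply: regularZ => //; apply: IH; exact: smooth_derive1.
Qed.

Lemma smooth_continuous f : smooth f -> continuous f.
Proof. by move/smooth_has_derivative/has_derivative_continuous. Qed.

End Calculus.

(** * Local integrability and primitives *)

Section LocalInt.
Context {R : realType}.
Local Notation mu := (@lebesgue_measure R).
Implicit Types f g h : R -> R.

Local Notation locint := (locally_integrable [set: R]).

Lemma continuous_locint f : continuous f -> locint f.
Proof.
move=> cf; split; [exact: continuous_measurable_fun|exact: openT|].
move=> K _ cK.
have /integrableP[_] : mu.-integrable K (EFin \o f).
  by apply: continuous_compact_integrable => //; exact: continuous_subspaceT.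
by [].
Qed.

Lemma locint_itv f a b : locint f -> mu.-integrable `[a, b] (EFin \o f).
Proof.
move=> [mf _ h]; apply/integrableP; split.
  by apply/measurable_EFinP; exact: measurable_funS mf.
exact: (h _ (@subsetT _ _) (@segment_compact _ _ _)).
Qed.

Lemma locint_measurable f : locint f -> measurable_fun setT f.
Proof. by case. Qed.

Lemma locint_intro f : measurable_fun setT f ->
  (forall a b, mu.-integrable `[a, b] (EFin \o f)) -> locint f.
Proof.
move=> mf h; split; [by []|exact: openT|move=> K _ cK].
have [M [_ KM]] := compact_bounded cK.
have {}KM : K `<=` `[- (M + 1), M + 1].
  move=> x Kx /=; rewrite in_itv/= -ler_norml.
  by apply: (KM (M + 1)) => //; rewrite ltrDl.
have /integrableP[_] := h (- (M + 1)) (M + 1); apply: le_lt_trans.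
apply: ge0_subset_integral => //; first exact: compact_measurable.
by apply/measurable_EFinP; apply: measurableT_comp => //; exact: measurable_funS mf.
Qed.

Lemma locint_sub f g : measurable_fun setT f ->
  (forall a b, exists K, forall x, a <= x <= b -> `|f x| <= K * `|g x|) ->
  locint g -> locint f.
Proof.
move=> mf h lg; apply: locint_intro => // a b; have [K hK] := h a b.
have iKg : mu.-integrable `[a, b] (fun x => K%:E * (g x)%:E)%E.
  by apply: integrableZl => //; exact: locint_itv.
apply: le_integrable iKg => //.
  by apply/measurable_EFinP; exact: measurable_funS mf.
move=> x /=; rewrite in_itv/= => /hK; rewrite lee_fin => /le_trans; apply.
by rewrite normrM ler_wpM2r// ler_norm.
Qed.

Lemma continuous_itv_bounded f a b : continuous f ->
  exists K, forall x, a <= x <= b -> `|f x| <= K.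
Proof.
move=> cf; have [ab|ba] := leP a b; last first.
  by exists 0 => x /andP[ax xb]; have := le_trans ax xb; rewrite leNgt ba.
have cn : continuous (fun x => `|f x|).
  by move=> x; apply: cvg_norm; exact: cf.
have [c _ hc] := EVT_max ab (continuous_subspaceT cn).
by exists `|f c| => x axb; apply: hc; rewrite in_itv.
Qed.

Lemma locintM f g : locint f -> continuous g -> locint (fun x => f x * g x).
Proof.
move=> lf cg; apply: locint_sub (lf).
  apply: measurable_funM; first exact: locint_measurable.
  exact: continuous_measurable_fun.
move=> a b; have [K hK] := continuous_itv_bounded a b cg.
by exists K => x /hK h; rewrite normrM mulrC ler_wpM2r.
Qed.

Lemma locintD f g : locint f -> locint g -> locint (fun x => f x + g x).
Proof. exact: locally_integrableD. Qed.

Lemma locintZ k f : locint f -> locint (fun x => k * f x).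
Proof.
move=> lf; apply: locint_sub (lf).
  by apply: measurable_funM => //; exact: locint_measurable lf.
by move=> a b; exists `|k| => x _; rewrite normrM.
Qed.

Lemma locintB f g : locint f -> locint g -> locint (fun x => f x - g x).
Proof. exact: locally_integrableB. Qed.

Lemma locint_norm f : locint f -> locint (fun x => `|f x|).
Proof.
move=> lf; apply: locint_sub (lf).
  by apply: measurableT_comp => //; exact: locint_measurable lf.
by move=> a b; exists 1 => y _; rewrite normr_id mul1r.
Qed.

Lemma locint_cst (k : R) : locint (fun=> k).
Proof. exact/continuous_locint/cst_continuous. Qed.

Lemma restrict_outside f a b : (forall x, ~~ (a <= x <= b) -> f x = 0) ->
  f \_ `[a, b] = f.
Proof.
move=> f0; apply/funext => x; rewrite patchE; case: ifPn => // /negP hx.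
by rewrite f0//; apply/negP => axb; apply: hx; rewrite inE/= in_itv.
Qed.

Lemma locint_integrable f a b : locint f ->
  (forall x, ~~ (a <= x <= b) -> f x = 0) -> mu.-integrable setT (EFin \o f).
Proof.
move=> lf f0; have := locint_itv a b lf.
by rewrite integrable_mkcond//= restrict_EFin restrict_outside.
Qed.

Lemma locint_integral f a b : (forall x, ~~ (a <= x <= b) -> f x = 0) ->
  \int[mu]_x f x = \int[mu]_(x in `[a, b]) f x.
Proof. by move=> f0; rewrite [RHS]Rintegral_mkcond restrict_outside. Qed.

(** The base point [- (|x| + 1)] lies to the left of both 0 and [x], so that
    one formula covers both signs of [x]; subtracting the integral up to 0
    removes the dependence on it. *)
Definition primitive f x :=
  \int[mu]_(t in `[- (`|x| + 1), x]) f t - \int[mu]_(t in `[- (`|x| + 1), 0]) f t.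

(** Moving the base point to the left adds the same integral to both terms;
    a base point that is locally constant in [x] is what continuity and
    differentiability call for. *)
Lemma primitive_base f x M : locint f -> `|x| + 1 <= M ->
  primitive f x = \int[mu]_(t in `[- M, x]) f t - \int[mu]_(t in `[- M, 0]) f t.
Proof.
move=> lf xM; rewrite /primitive.
set m := - (`|x| + 1); have Mm : - M <= m by rewrite lerN2.
have mx : m < x.
  by rewrite /m; have := ler_norm (- x); rewrite normrN; lra.
have m0 : m < 0 by rewrite /m; have := normr_ge0 x; lra.
have H y : m < y -> \int[mu]_(t in `[- M, y]) f t =
    \int[mu]_(t in `[- M, m]) f t + \int[mu]_(t in `[m, y]) f t.
  move=> my; rewrite -(@Rintegral_itv_obnd_cbnd _ m (BRight y)); last first.
    by apply: integrableS (locint_itv m y lf) => //; by apply: subset_itvr; rewrite bnd_simp.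
  rewrite -(@Rintegral_itvB _ _ (BLeft (- M)) (BRight y) m).
  - by rewrite addrC subrK.
  - exact: locint_itv.
  - by rewrite bnd_simp.
  - by rewrite bnd_simp ltW.
by rewrite (H _ mx) (H _ m0); ring.
Qed.

Lemma primitiveB f a b : locint f -> a <= b ->
  primitive f b - primitive f a = \int[mu]_(t in `]a, b]) f t.
Proof.
move=> lf ab.
set M := Num.max (`|a| + 1) (`|b| + 1).
have Ma : `|a| + 1 <= M by rewrite le_max lexx.
have Mb : `|b| + 1 <= M by rewrite le_max lexx orbT.
rewrite (primitive_base lf Ma) (primitive_base lf Mb).
rewrite -(@Rintegral_itvB _ _ (BLeft (- M)) (BRight b) a).
- by ring.
- exact: locint_itv.
- rewrite bnd_simp; have := ler_norm (- a); rewrite normrN; lra.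
- by rewrite bnd_simp.
Qed.

Lemma near_norm_lt (x : R) : \forall y \near x, `|y| < `|x| + 1.
Proof.
exists 1 => //= y; rewrite /ball_/= distrC => h.
by have := ler_normD (y - x) x; rewrite subrK; lra.
Qed.

Lemma primitive_continuous f : locint f -> continuous (primitive f).
Proof.
move=> lf x; set M := `|x| + 2.
have cI := @parameterized_integral_continuous R (- M) M f _ (locint_itv (- M) M lf).
have M0 : - M < M by rewrite /M; have := normr_ge0 x; lra.
have xM : x \in `]- M, M[.
  rewrite in_itv/= -ltr_norml /M; lra.
have cx := within_continuous_continuous M0 (cI (ltW M0)) xM.
pose g y := parameterized_integral mu (- M) y f - \int[mu]_(t in `[- M, 0]) f t.
have cg : {for x, continuous g} by apply: cvgB; [exact: cx|exact: cvg_cst].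
have xg : primitive f x = g x by rewrite (@primitive_base _ _ M)// /M; lra.
rewrite /continuous_at xg.
apply: cvg_trans cg; apply: near_eq_cvg; near=> y.
rewrite (@primitive_base _ _ M)// /M.
suff : `|y| < `|x| + 1 by lra.
by near: y; exact: near_norm_lt.
Unshelve. all: by end_near. Qed.

Lemma primitive_derivative f : continuous f -> has_derivative (primitive f) f.
Proof.
move=> cf x; have lf := continuous_locint cf; set M := `|x| + 2.
have xM : x < M by rewrite /M; have := ler_norm x; lra.
have Mx : - M < x by rewrite /M; have := ler_norm (- x); rewrite normrN; lra.
have [d1 d2] := continuous_FTC1_closed xM (locint_itv (- M) M lf) Mx (cf x).
have h : is_derive x 1 (fun y => \int[mu]_(t in `[- M, y]) f t
    - \int[mu]_(t in `[- M, 0]) f t) (f x - 0).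
  by apply: is_deriveB; apply: DeriveDef; rewrite -?derive1E.
rewrite -[f x]subr0.
apply: near_eq_is_derive h; near=> y.
rewrite (@primitive_base _ _ M)// /M.
suff : `|y| < `|x| + 1 by lra.
by near: y; exact: near_norm_lt.
Unshelve. all: by end_near. Qed.

Lemma FTC2 F f a b : has_derivative F f -> continuous f -> a <= b ->
  \int[mu]_(t in `[a, b]) f t = F b - F a.
Proof.
move=> hF cf; rewrite le_eqVlt => /predU1P[<-|ab].
  by rewrite set_itv1 Rintegral_set1 subrr.
have cF := has_derivative_continuous hF.
rewrite /Rintegral (@continuous_FTC2 _ f F a b)//.
- exact: continuous_subspaceT.
- split.
  + by move=> x _; exact: ex_derive.
  + exact: cvg_at_right_filter (cF a).
  + exact: cvg_at_left_filter (cF b).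
- by move=> x _; rewrite (has_derivativeE hF).
Qed.

End LocalInt.

(** * Functions flat at the origin *)

Section Bump.
Context {R : realType}.
Implicit Types f g df dg : R -> R.

Lemma is_derive_flat f (K : R) : (forall x, `|f x| <= K * x ^+ 2) ->
  is_derive (0 : R) 1 f 0.
Proof.
move=> h.
have f0 : f 0 = 0.
  by apply/eqP; rewrite -normr_le0 (le_trans (h 0))// expr0n/= mulr0.
have K0 : 0 <= K by have := le_trans (normr_ge0 _) (h 1); rewrite expr1n mulr1.
suff c : (fun t : R => t^-1 *: (f (t *: 1 + 0) - f 0)) @ (0 : R)^' --> (0 : R).
  apply: DeriveDef; first by apply/cvg_ex; exists 0.
  by apply/cvg_lim => //; exact: Rhausdorff.
apply/cvgr0Pnorm_le => e e0.
have [d d0 hd] : exists2 d : R, 0 < d & K * d <= e.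
  exists (e / (K + 1)); first by rewrite divr_gt0// ltr_wpDl.
  rewrite mulrA ler_pdivrMr ?ltr_wpDl// mulrC ler_wpM2l ?(ltW e0)//.
  by rewrite lerDl.
exists d => //= t; rewrite /ball_/= sub0r normrN => td t0.
rewrite f0 subr0 addr0 /GRing.scale/= mulr1 normrM normfV.
rewrite mulrC ler_pdivrMr ?normr_gt0//.
apply: (le_trans (h t)); rewrite -(real_normK (num_real t)) expr2 mulrA.
by rewrite ler_wpM2r// (le_trans _ hd)// ler_wpM2l// ltW.
Qed.

(** The family is closed under differentiation up to linear combinations
    (see [has_derivative_flat_exp]), so all derivatives of [flat_exp 0] are
    controlled at once. *)
Definition flat_exp (n : nat) (t : R) : R :=
  if 0 < t then t ^- n * expR (- t^-1) else 0.

Lemma flat_exp_eq0 n x : x <= 0 -> flat_exp n x = 0.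
Proof. by move=> x0; rewrite /flat_exp ltNge x0. Qed.

(** From e^s >= s^(n+2) / (n+2)! at s = 1/x: the quadratic bound makes the
    derivative at 0 vanish. *)
Lemma flat_exp_le n x : `|flat_exp n x| <= (n.+2)`!%:R * x ^+ 2.
Proof.
rewrite /flat_exp; case: ifPn => x0; last first.
  by rewrite normr0 mulr_ge0// sqr_ge0.
have xi0 : 0 < x^-1 by rewrite invr_gt0.
rewrite ger0_norm; last by rewrite mulr_ge0// ?expR_ge0// invr_ge0 exprn_ge0 ?ltW.
rewrite expRN -exprVn ler_pdivrMr ?expR_gt0//.
have h := expR_ge1Dxn n.+1 (ltW xi0).
have f0 : 0 < (n.+2)`!%:R :> R by rewrite ltr0n fact_gt0.
have {}h : x^-1 ^+ n.+2 / (n.+2)`!%:R <= expR x^-1.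
  by apply: le_trans h; rewrite lerDr.
move: h; rewrite ler_pdivrMr// => h.
rewrite -mulrA [x^+2 * _]mulrC mulrA [_%:R * _]mulrC.
apply: (@le_trans _ _ (x^-1 ^+ n.+2 * x ^+ 2)); last first.
  by rewrite ler_wpM2r// sqr_ge0.
rewrite -addn2 exprD exprVn -mulrA exprVn [x ^- 2 * _]mulVf ?mulr1//.
by rewrite expf_neq0// gt_eqF.
Qed.

Lemma has_derivative_flat_exp n : has_derivative (flat_exp n)
  (fun x => flat_exp n.+2 x - n%:R * flat_exp n.+1 x).
Proof.
move=> x; have [x0|x0|->] := ltgtP x 0.
- rewrite !flat_exp_eq0 ?(ltW x0)// mulr0 subr0.
  apply: (@near_eq_is_derive R R R (cst 0)).
  near=> y; rewrite flat_exp_eq0//.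
  by near: y; exact: lt_le_nbhsl.
- have E m : flat_exp m x = x ^- m * expR (- x^-1) by rewrite /flat_exp x0.
  rewrite !E.
  apply: (@near_eq_is_derive R R R
    (fun y : R => (y^-1) ^+ n * expR (- 1 * y^-1))).
    near=> y; rewrite /flat_exp; suff -> : 0 < y by rewrite exprVn mulN1r.
    by near: y; exact: lt_nbhsr.
  have hi : is_derive x 1 (fun y : R => y^-1) (- x ^- 2 *: 1).
    by apply: (@is_deriveV _ id) => //; rewrite gt_eqF.
  have hp : is_derive x 1 (fun y : R => y^-1 ^+ n)
      (n%:R * x^-1 ^+ n.-1 * (- x ^- 2)).
    rewrite (_ : (fun y => _) = (fun y : R => y^-1) ^+ n); last first.
      by apply/funext => y; rewrite exprfctE.
    by apply: is_derive_eq (is_deriveX n hi) _; rewrite /GRing.scale/= mulr1.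
  have he : is_derive x 1 (fun y : R => expR (- 1 * y^-1))
      (- 1 * expR (- 1 * x^-1) * (- x ^- 2 *: 1)).
    exact: (@is_derive1_comp _ (fun y => expR (- 1 * y)) (fun y => y^-1) x _ _
      (has_derivative_expR (- 1) x^-1) hi).
  have := is_deriveM hp he => /is_derive_eq; apply.
  rewrite /GRing.scale/= !mulr1 !mulN1r.
  rewrite -!exprVn; move: (x^-1) (expR _) => u e; case: n {hp} => [|n] /=.
    by rewrite !mul0r subr0 mulr0 addr0 expr0 mul1r mulrNN mulrC.
  by rewrite !exprS; ring.
- rewrite !flat_exp_eq0// mulr0 subr0.
  apply: (@is_derive_flat _ (n.+2)`!%:R); exact: flat_exp_le.
Unshelve. all: by end_near. Qed.

Lemma smooth_flat_exp n : smooth (flat_exp n).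
Proof.
apply: (@regular_smooth _ (fun=> True)) => m; elim: m n => [//|m IH] n.
split => //; eexists; first exact: has_derivative_flat_exp.
apply: (eq_ind (fun x => flat_exp n.+2 x + (- n%:R) * flat_exp n.+1 x)
   (regular (fun=> True) m)).
  by apply: regularD => //; apply: regularZ.
by apply/funext => x; rewrite mulNr.
Qed.

Lemma flat_exp_gt0 n x : 0 < x -> 0 < flat_exp n x.
Proof.
by move=> x0; rewrite /flat_exp x0 mulr_gt0// ?expR_gt0// invr_gt0 exprn_gt0.
Qed.

Lemma flat_exp_ge0 n x : 0 <= flat_exp n x.
Proof.
have [x0|x0] := leP x 0; first by rewrite flat_exp_eq0.
by rewrite ltW// flat_exp_gt0.
Qed.

Lemma flat_exp0_le1 x : flat_exp 0 x <= 1.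
Proof.
rewrite /flat_exp; case: ifPn => // x0.
by rewrite expr0 invr1 mul1r expR_le1 oppr_le0 invr_ge0 ltW.
Qed.

End Bump.

(** * Smooth steps and test functions *)

Section Step.
Context {R : realType}.
Local Notation mu := (@lebesgue_measure R).
Implicit Types f g h eta : R -> R.
Local Notation locint := (locally_integrable [set: R]).

(** [Phi] goes smoothly from 0 to 1 on [0, 1], [rho] is its derivative and
    [Psi] its primitive.  Rescaled, [rho] approximates a point mass, [Phi] a
    jump and [Psi] a corner, so combinations of them with compact support are
    test functions whose derivatives are combinations of near point masses.
    The unit interval lies on one side of the origin in order that jumps
    converge everywhere, without exceptional points. *)
Record smooth_step (rho Phi Psi : R -> R) : Prop := SmoothStep {
  step_smooth : smooth rho;
  step_derivative : has_derivative Phi rho;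
  step_derivative2 : has_derivative Psi Phi;
  step_rho_ge0 : forall x, 0 <= rho x;
  step_rho_bounded : exists K, forall x, rho x <= K;
  step_rho_out : forall x, ~~ (0 <= x <= 1) -> rho x = 0;
  step_left : forall x, x <= 0 -> Phi x = 0;
  step_right : forall x, 1 <= x -> Phi x = 1;
  step_left2 : forall x, x <= 0 -> Psi x = 0;
  step_right2 : exists m, forall x, 1 <= x -> Psi x = x - m }.

Lemma smooth_step_exists : exists rho Phi Psi, smooth_step rho Phi Psi.
Proof.
pose bump (x : R) : R := flat_exp 0 x * flat_exp 0 (- 1 * x + 1).
have sb : smooth bump.
  have h := @smooth_flat_exp R 0.
  exact: smoothM h (@smooth_affine R _ (- 1) 1 h).
have b_ge0 x : 0 <= bump x by rewrite mulr_ge0// flat_exp_ge0.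
have b_gt0 x : 0 < x < 1 -> 0 < bump x.
  by move=> /andP[x0 x1]; rewrite mulr_gt0// flat_exp_gt0//; lra.
have b_out x : ~~ (0 <= x <= 1) -> bump x = 0.
  rewrite negb_and -!ltNge => /orP[h|h]; rewrite /bump.
    by rewrite flat_exp_eq0 ?mul0r// ltW.
  by rewrite [X in _ * X]flat_exp_eq0 ?mulr0//; lra.
have b0 : bump 0 = 0 by rewrite /bump flat_exp_eq0 ?mul0r.
have b1 : bump 1 = 0 by rewrite /bump [X in _ * X]flat_exp_eq0 ?mulr0//; lra.
have b_left x : x <= 0 -> bump x = 0.
  by move=> x0; rewrite /bump flat_exp_eq0 ?mul0r.
have b_right x : 1 <= x -> bump x = 0.
  by move=> x0; rewrite /bump [X in _ * X]flat_exp_eq0 ?mulr0//; lra.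
have b_le1 x : bump x <= 1.
  by rewrite -[leRHS]mulr1 ler_pM// ?flat_exp_ge0// flat_exp0_le1.
pose P := primitive bump.
have hP : has_derivative P bump by apply/primitive_derivative/smooth_continuous.
have P_homo x y : x <= y -> P x <= P y.
  by move=> xy; apply: (has_derivative_nondecreasing hP) xy => //.
(* The mass of the bump is positive because the bump is positive on [1/4, 1/2]. *)
have c_gt0 : 0 < P 1 - P 0.
  have lehalf : 4^-1 <= 2^-1 :> R by lra.
  have [t /andP[t1 t2] e] := has_derivative_MVT hP lehalf.
  have := b_gt0 t; rewrite (_ : 0 < t < 1); last by apply/andP; split; lra.
  move=> /(_ isT) bt.
  have half_gt : 0 < P 2^-1 - P 4^-1 by rewrite e mulr_gt0//; lra.
  rewrite subr_gt0 (@le_lt_trans _ _ (P 4^-1)) ?P_homo ?invr_ge0//.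
  rewrite (@lt_le_trans _ _ (P 2^-1))//; first by rewrite -subr_gt0.
  by rewrite P_homo// invf_le1// ler1n.
set c := P 1 - P 0 in c_gt0.
pose rho x := c^-1 * bump x; pose Phi x := c^-1 * (P x - P 0).
have hPhi : has_derivative Phi rho.
  apply: has_derivative_ext (has_derivativeZ c^-1
    (has_derivativeB hP (has_derivative_cst (P 0)))) _ => x.
  by rewrite subr0.
have cPhi := has_derivative_continuous hPhi.
have hQ := primitive_derivative cPhi.
pose Psi x := primitive Phi x - primitive Phi 0.
have hPsi : has_derivative Psi Phi.
  apply: has_derivative_ext (has_derivativeB hQ (has_derivative_cst _)) _ => x.
  by rewrite subr0.
have Phi_left x : x <= 0 -> Phi x = 0.
  move=> x0; rewrite /Phi -(constant_of_derivative hP x0) ?subrr ?mulr0//.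
  by move=> t /andP[_ /b_left].
have Phi_right x : 1 <= x -> Phi x = 1.
  move=> x1; rewrite /Phi (constant_of_derivative hP x1).
    by rewrite mulVf// gt_eqF.
  by move=> t /andP[/b_right].
exists rho, Phi, Psi; split.
- exact: smoothZ.
- exact: hPhi.
- exact: hPsi.
- by move=> x; rewrite mulr_ge0// invr_ge0 ltW.
- exists c^-1 => x; rewrite -[leRHS]mulr1 ler_wpM2l//.
  by rewrite invr_ge0 ltW.
- by move=> x /b_out h; rewrite /rho h mulr0.
- exact: Phi_left.
- exact: Phi_right.
- move=> x x0; rewrite /Psi -(constant_of_derivative hQ x0) ?subrr//.
  by move=> t /andP[_ /Phi_left].
- exists (1 - Psi 1) => x x1.
  have h : has_derivative (fun x => Psi x - x) (fun x => Phi x - 1).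
    exact: has_derivativeB hPsi (@has_derivative_id R).
  have /= E : Psi x - x = Psi 1 - 1.
    apply: (constant_of_derivative h x1) => t /andP[/Phi_right -> _].
    exact: subrr.
  lra.
Qed.

Lemma test_function_intro eta a b : smooth eta ->
  (forall x, ~~ (a <= x <= b) -> eta x = 0) -> test_function eta.
Proof.
move=> se h; split => //; apply: (@subclosed_compact _ _ `[a, b]).
- exact: closed_closure.
- exact: segment_compact.
- rewrite [X in _ `<=` X]((closure_id _).1 (@itv_closed _ R a b)).
  apply: closureS => x /= ex; rewrite in_itv/=.
  by apply: contraNT ex => /h ->.
Qed.

Lemma test_function_support eta : test_function eta ->
  exists2 M, 0 < M & forall x, ~~ (- M <= x <= M) -> eta x = 0.
Proof.
move=> [_ /compact_bounded[M [_ hM]]].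
exists (Num.max M 0 + 1); first by rewrite ltr_wpDl// le_max lexx orbT.
move=> x; apply: contraNeq => ex; rewrite -ler_norml.
apply: hM; last exact: subset_closure.
by rewrite (@le_lt_trans _ _ (Num.max M 0))// ?le_max ?lexx// ltrDl.
Qed.

Lemma derive1_outside eta a b : (forall x, ~~ (a <= x <= b) -> eta x = 0) ->
  forall x, ~~ (a <= x <= b) -> derive1 eta x = 0.
Proof.
move=> h x hx; rewrite derive1E; apply: derive_val.
apply: (@near_eq_is_derive R R R (cst 0)).
near=> y; rewrite h//; near: y.
move: hx; rewrite negb_and -!ltNge => /orP[xa|bx].
  by apply: filterS (lt_nbhsl xa) => y; rewrite negb_and -!ltNge => ->.
by apply: filterS (lt_nbhsr bx) => y; rewrite negb_and -!ltNge => ->; rewrite orbT.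
Unshelve. all: by end_near. Qed.

Lemma test_function_derive1 eta : test_function eta -> test_function (derive1 eta).
Proof.
move=> te; have [M _ hM] := test_function_support te.
by apply: (test_function_intro (smooth_derive1 te.1)); exact: derive1_outside hM.
Qed.

End Step.

(** * Smooth approximations of a point mass at Lebesgue points *)

Section LebesguePoints.
Context {R : realType}.
Local Notation mu := (@lebesgue_measure R).
Implicit Types f g h w eta : R -> R.
Local Notation locint := (locally_integrable [set: R]).

Lemma itv_ge0_fin f a b : locint f ->
  (\int[mu]_(y in `[a, b]) `|f y|)%:E = (\int[mu]_(y in `[a, b]) `|(f y)%:E|)%E.
Proof.
move=> lf; rewrite /Rintegral fineK//; apply: integrable_fin_num => //.
by move: (locint_itv a b lf) => /integrable_norm.
Qed.

(** One-sided averages are dominated by centered ones, at the cost of a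
    factor 4 from the length of the ball of radius [2 * r]. *)
Lemma lebesgue_pt_right w x e : locint w -> lebesgue_pt w x -> 0 < e ->
  \forall r \near 0^'+, \int[mu]_(y in `[x, x + r]) `|w y - w x| <= e * r.
Proof.
move=> lw wx e0.
have lwx : locint (fun y => w y - w x).
  apply: (locintD lw); exact: (continuous_locint (@cst_continuous _ _ (- w x))).
have e4 : (0 < (e / 4)%:E)%E by rewrite lte_fin divr_gt0.
have [d /= d0 hd] := wx _ (open_ereal_lt' e4).
exists (d / 2); first by rewrite /= divr_gt0.
move=> r /=; rewrite sub0r normrN => rd r0.
have r20 : 0 < 2 * r by rewrite mulr_gt0.
have {}hd : (davg w x (2 * r) < (e / 4)%:E)%E.
  apply: hd => //=; rewrite sub0r normrN (gtr0_norm r20).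
  by move: rd; rewrite (gtr0_norm r0); lra.
rewrite -lee_fin itv_ge0_fin//.
move: hd; rewrite /davg /iavg lebesgue_measure_ball ?(ltW r20)//.
rewrite inver mulrn_eq0/= gt_eqF//= => /ltW.
rewrite muleC lee_pdivrMr; last by lra.
move=> hd; rewrite (_ : e * r = e / 4 * (2 * r *+ 2)); last by lra.
apply: le_trans hd.
apply: ge0_subset_integral => //=.
- exact: measurable_ball.
- apply/measurable_EFinP; apply: measurableT_comp => //.
  exact: measurable_funS (locint_measurable lwx).
- move=> y /=; rewrite in_itv/= /ball/= => /andP[xy yxr].
  by rewrite ltr_distl; lra.
Qed.

Variables (rho Phi Psi : R -> R).
Hypothesis step : smooth_step rho Phi Psi.

Definition step_kernel (k x y : R) := k * rho (k * y + - (k * x)).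

Lemma rescale_in (k x y : R) : 0 < k ->
  (0 <= k * y + - (k * x) <= 1) = (x <= y <= x + k^-1).
Proof.
move=> k0; rewrite -mulrBr pmulr_rge0// subr_ge0; congr andb.
by rewrite mulrC -ler_pdivlMr// mul1r lerBlDl.
Qed.

Lemma kernel_out k x y : 0 < k -> ~~ (x <= y <= x + k^-1) -> step_kernel k x y = 0.
Proof.
by move=> k0; rewrite -rescale_in// /step_kernel => /(step_rho_out step) ->; rewrite mulr0.
Qed.

Lemma kernel_continuous k x : continuous (step_kernel k x).
Proof.
have h : smooth (step_kernel k x).
  exact: (@smoothZ R k _ (@smooth_affine R rho k (- (k * x)) (step_smooth step))).
exact: smooth_continuous.
Qed.

Lemma kernel_integral k x : 0 < k ->
  \int[mu]_(y in `[x, x + k^-1]) step_kernel k x y = 1.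
Proof.
move=> k0.
have hd := has_derivative_affine k (- (k * x)) (step_derivative step).
rewrite (FTC2 hd).
- by rewrite subrr mulrDr mulfV ?gt_eqF// addrAC subrr add0r
    (step_right step) ?(step_left step)// subr0.
- exact: kernel_continuous.
- by rewrite lerDl invr_ge0 ltW.
Qed.

(** The kernel has mass 1 and lives on an interval of length inverse to its
    height, so the error is an average of |w - w x| over that interval. *)
Lemma kernel_cvg w x : locint w -> lebesgue_pt w x ->
  \int[mu]_y (w y * step_kernel n.+1%:R x y) @[n --> \oo] --> w x.
Proof.
move=> lw wx; have [K hK] := step_rho_bounded step.
have K0 : 0 <= K := le_trans (step_rho_ge0 step 0) (hK 0).
apply/cvgrPdist_le => e e0.
have e'0 : 0 < e / (K + 1) by rewrite divr_gt0// ltr_wpDl.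
have [d /= d0 hd] := lebesgue_pt_right lw wx e'0.
near=> n; set k : R := n.+1%:R.
have k0 : 0 < k by rewrite /k ltr0n.
have kd : k^-1 < d.
  rewrite /k; near: n; exact: near_infty_natSinv_lt (PosNum d0).
have {}hd : \int[mu]_(y in `[x, x + k^-1]) `|w y - w x| <= e / (K + 1) * k^-1.
  by apply: hd; rewrite ?invr_gt0//= sub0r normrN gtr0_norm ?invr_gt0.
have lk : locint (step_kernel k x) by exact/continuous_locint/kernel_continuous.
have cx := locintZ (w x) lk.
have lwk := locintM lw (@kernel_continuous k x).
have lwx : locint (fun y => `|w y - w x|).
  exact/locint_norm/locintB/locint_cst.
rewrite (@locint_integral _ _ x (x + k^-1)); last first.
  by move=> y hy; rewrite kernel_out ?mulr0.
have -> : w x = \int[mu]_(y in `[x, x + k^-1]) (w x * step_kernel k x y).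
  rewrite RintegralZl// ?kernel_integral ?mulr1//.
  exact: locint_itv.
rewrite -RintegralB//; [|exact: locint_itv..].
have lD := locintB cx lwk.
apply: le_trans (le_normr_Rintegral _ _) _ => //; first exact: locint_itv.
apply: (@le_trans _ _ (\int[mu]_(y in `[x, x + k^-1]) (K * k * `|w y - w x|))).
  apply: le_Rintegral => //; first exact: locint_itv (locint_norm lD).
    exact: locint_itv (locintZ (K * k) lwx).
  move=> y _; rewrite -mulrBl normrM mulrC distrC.
  have kK : step_kernel k x y <= K * k by rewrite /step_kernel mulrC ler_wpM2r// ltW.
  have k_ge0 : 0 <= step_kernel k x y.
    by rewrite mulr_ge0 ?(step_rho_ge0 step)// ltW.
  by rewrite (ger0_norm k_ge0) ler_wpM2r.
rewrite RintegralZl//; last exact: locint_itv.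
apply: (@le_trans _ _ (K * k * (e / (K + 1) * k^-1))).
  by rewrite ler_wpM2l// mulr_ge0// ltW.
rewrite [_ * k^-1]mulrC mulrA mulfK ?gt_eqF//.
rewrite mulrA ler_pdivrMr ?ltr_wpDl// mulrC ler_wpM2l ?lerDl//.
exact: ltW.
Unshelve. all: by end_near. Qed.

End LebesguePoints.

(** * The lemmas of du Bois-Reymond *)

Section DuBoisReymond.
Context {R : realType}.
Local Notation mu := (@lebesgue_measure R).
Implicit Types f g h w u eta : R -> R.
Local Notation locint := (locally_integrable [set: R]).

Lemma in_L2_measurable u : in_L2 u -> measurable_fun setT u.
Proof. by rewrite /in_L2 inE => /andP[]; rewrite inE. Qed.

(** Because |u| <= 1 + u^2. *)
Lemma in_L2_locint u : in_L2 u -> locint u.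
Proof.
move=> u2; have mu2 := in_L2_measurable u2.
apply: locint_intro => // a b.
have h : mu.-integrable `[a, b] (fun x => (1 : R)%:E + (u x ^+ 2)%:E)%E.
  apply: integrableD => //; first exact: (locint_itv a b (locint_cst 1)).
  have iu2 := Lfun2_integrable_sqr u2.
  by apply: (integrableS _ _ _ iu2).
apply: le_integrable h => //.
  by apply/measurable_EFinP; exact: measurable_funS mu2.
move=> x _ /=; rewrite lee_fin.
have := sqr_ge0 (`|u x| - 1); rewrite -[u x ^+ 2]real_normK ?num_real// => h.
by rewrite [leRHS]ger0_norm; have := sqr_ge0 `|u x|; have := normr_ge0 (u x); lra.
Qed.

Lemma ae_exists (P : R -> Prop) a b : {ae mu, forall x, P x} -> a < b ->
  exists2 x, a < x < b & P x.
Proof.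
move=> [A [mA A0 PA]] ab; apply: contrapT => hn.
have : (mu `]a, b[ <= mu A)%E.
  apply: le_measure; rewrite ?inE//= => x /=; rewrite in_itv/= => xab.
  by apply: PA => /= Px; apply: hn; exists x.
rewrite A0 lebesgue_measure_itv/= lte_fin ab -EFinD lee_fin.
by rewrite leNgt subr_gt0 ab.
Qed.

Lemma aeS (P Q : R -> Prop) : (forall x, P x -> Q x) ->
  {ae mu, forall x, P x} -> {ae mu, forall x, Q x}.
Proof.
by move=> PQ; apply: filterS; first exact: (ae_filter_ringOfSetsType mu).
Qed.

Lemma aeI (P Q : R -> Prop) : {ae mu, forall x, P x} -> {ae mu, forall x, Q x} ->
  {ae mu, forall x, P x /\ Q x}.
Proof.
by move=> p q; apply: filterI p q; exact: (ae_filter_ringOfSetsType mu).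
Qed.

(** Uniqueness of weak derivatives: at a Lebesgue point the tested integrals
    converge to the value of the function. *)
Lemma ae_zero_of_weak w : locint w ->
  (forall eta, test_function eta -> \int[mu]_x (w x * eta x) = 0) ->
  {ae mu, forall x, w x = 0}.
Proof.
move=> lw hw; have [rho [Phi [Psi step]]] := @smooth_step_exists R.
apply: aeS (lebesgue_differentiation lw) => x wx.
have := kernel_cvg step lw wx.
under eq_fun => n.
  rewrite hw; first over.
  apply: (@test_function_intro _ _ x (x + n.+1%:R^-1)).
    exact: (@smoothZ R _ _ (@smooth_affine R rho _ _ (step_smooth step))).
  by move=> y hy; apply: (kernel_out step _ hy); rewrite ltr0n.
by move=> /cvg_unique; apply => //; exact: cvg_cst.
Qed.

Lemma dominated_Rintegral (D : set R) (f_ : nat -> R -> R) f g :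
  measurable D -> (forall n, measurable_fun D (f_ n)) -> measurable_fun D f ->
  (forall y, f_ n y @[n --> \oo] --> f y) -> mu.-integrable D (EFin \o g) ->
  (forall n y, D y -> `|f_ n y| <= g y) ->
  \int[mu]_(y in D) f_ n y @[n --> \oo] --> \int[mu]_(y in D) f y.
Proof.
move=> mD mf_ mf cf ig fg.
have [||||iF _ cvF] := @dominated_convergence _ _ R mu D mD
    (fun n => EFin \o f_ n) (EFin \o f) (EFin \o g) _ _ _ ig _.
- by move=> n; apply/measurable_EFinP; exact: mf_.
- exact/measurable_EFinP.
- apply: aeW => y _; apply: cvg_EFin; last exact: cf.
  exact: nearW.
- by apply: aeW => y n Dy; rewrite lee_fin; exact: fg.
apply: fine_cvg; rewrite fineK//; exact: integrable_fin_num.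
Qed.

Lemma step_bounds (rho Phi Psi : R -> R) x : smooth_step rho Phi Psi ->
  0 <= Phi x <= 1.
Proof.
move=> step.
have mono y z : y <= z -> Phi y <= Phi z.
  move=> yz; apply: (has_derivative_nondecreasing (step_derivative step)) yz => //.
  by move=> t _; exact: step_rho_ge0 step t.
apply/andP; split.
  rewrite -(step_left step (x := Num.min x 0)) ?ge_min ?lexx ?orbT//.
  by rewrite mono// ge_min lexx.
rewrite -(step_right step (x := Num.max x 1)) ?le_max ?lexx ?orbT//.
by rewrite mono// le_max lexx.
Qed.

(** Test with a smooth approximation of the indicator function of ]a, b]: its
    derivative approaches the difference of the point masses at [a] and [b]. *)
Lemma increment_of_weak_derivative w h a b : locint w -> locint h ->
  (forall eta, test_function eta ->
    \int[mu]_x (w x * derive1 eta x) = - \int[mu]_x (h x * eta x)) ->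
  lebesgue_pt w a -> lebesgue_pt w b -> a < b ->
  w b - w a = \int[mu]_(x in `]a, b]) h x.
Proof.
move=> lw lh hwh wa wb ab; have [rho [Phi [Psi step]]] := @smooth_step_exists R.
pose k n : R := n.+1%:R.
have k0 n : 0 < k n by rewrite /k ltr0n.
have ki1 n : (k n)^-1 <= 1 by rewrite invf_le1// /k ler1n.
pose s n x y := Phi (k n * y + - (k n * x)).
pose eta n y := s n a y + -1 * s n b y.
have hs n x : has_derivative (s n x) (step_kernel rho (k n) x).
  exact: (has_derivative_affine (k n) _ (step_derivative step)).
have heta n : has_derivative (eta n)
    (fun y => step_kernel rho (k n) a y + - 1 * step_kernel rho (k n) b y).
  exact: has_derivativeD (hs n a) (has_derivativeZ _ (hs n b)).
have s_left n x y : y <= x -> s n x y = 0.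
  by move=> yx; rewrite /s (step_left step)// -mulrBr pmulr_rle0 ?subr_le0.
have s_right n x y : x + (k n)^-1 <= y -> s n x y = 1.
  move=> yx; rewrite /s (step_right step)// -mulrBr mulrC -ler_pdivrMr// mul1r.
  by rewrite lerBrDl.
have eta_out n y : ~~ (a <= y <= b + 1) -> eta n y = 0.
  rewrite negb_and -!ltNge => /orP[ya|yb]; rewrite /eta.
    by rewrite (s_left _ a) ?(s_left _ b) ?mulr0 ?addr0 ?ltW// (lt_trans ya).
  have kn c : c <= b -> c + (k n)^-1 <= y.
    by move=> cb; rewrite (le_trans (lerD cb (ki1 n)))// ltW.
  by rewrite (s_right _ a) ?(s_right _ b) ?mulN1r ?subrr// kn// ltW.
have seta n : smooth (eta n).
  apply: has_derivative_smooth (heta n) _.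
  have sk x : smooth (step_kernel rho (k n) x).
    exact: (@smoothZ R _ _ (@smooth_affine R rho _ _ (step_smooth step))).
  exact: (@smoothD R _ _ (sk a) (@smoothZ R (-1) _ (sk b))).
have ceta n : continuous (eta n) by exact: smooth_continuous.
have eta_le1 n y : `|eta n y| <= 1.
  have := step_bounds (k n * y + - (k n * a)) step.
  have := step_bounds (k n * y + - (k n * b)) step.
  by rewrite /eta /s ler_norml; lra.
(* Each value of eta is eventually constant in n, with value the indicator of ]a, b]. *)
have cvg_eta y : h y * eta n y @[n --> \oo] --> (h \_ `]a, b]) y.
  have cs x : x < y -> \forall n \near \oo, s n x y = 1.
    move=> xy; have yx0 : 0 < y - x by rewrite subr_gt0.
    near=> n; rewrite s_right// -lerBrDl ltW//.
    by rewrite /k; near: n; exact: near_infty_natSinv_lt (PosNum yx0).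
  rewrite patchE; case: ifPn => [|/negP]; rewrite inE/= in_itv/=.
    move=> /andP[ay yb]; apply: cvg_near_cst.
    apply: filterS (cs a ay) => n sn.
    by rewrite /eta sn s_left// mulr0 addr0 mulr1.
  move=> /negP; rewrite negb_and -leNgt -ltNge => /orP[ya|yb].
    apply: cvg_near_cst; apply: nearW => n.
    by rewrite /eta (s_left _ a)// (s_left _ b) ?mulr0 ?addr0 ?mulr0//; lra.
  apply: cvg_near_cst.
  have ay := lt_trans ab yb.
  apply: filterS2 (cs a ay) (cs b yb) => n sa sb.
  by rewrite /eta sa sb mulN1r subrr mulr0.
have lhe n : locint (fun y => h y * eta n y) by exact: locintM.
have lhab : mu.-integrable `[a, b + 1] (EFin \o h) by exact: locint_itv.
have sub_ab : `]a, b] `<=` `[a, b + 1].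
  by apply: subset_itv; rewrite bnd_simp// lerDl.
have mhab : measurable_fun setT (h \_ `]a, b]).
  apply/(measurable_restrictT _ _).1 => //.
  exact: measurable_funS (locint_measurable lh).
have cvg_int : \int[mu]_(y in `[a, b + 1]) (h y * eta n y) @[n --> \oo] -->
    \int[mu]_(y in `[a, b + 1]) (h \_ `]a, b]) y.
  apply: (@dominated_Rintegral _ _ _ (fun y => `|h y|)) => //.
  - by move=> n; apply: measurable_funTS; exact: locint_measurable (lhe n).
  - exact: measurable_funTS.
  - exact: locint_itv (locint_norm lh).
  - by move=> n y _; rewrite normrM ler_piMr.
move: cvg_int; rewrite -Rintegral_mkcondr (setIidr sub_ab) => cvg_int.
pose W n x := \int[mu]_y (w y * step_kernel rho (k n) x y).
have cvg_diff : (W n a - W n b) @[n --> \oo] --> w a - w b.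
  apply: cvgB; first exact: (kernel_cvg step lw wa).
  exact: (kernel_cvg step lw wb).
have cvg_int' :
    (- (\int[mu]_(y in `[a, b + 1]) (h y * eta n y))) @[n --> \oo] --> w a - w b.
  apply: cvg_trans cvg_diff; apply: near_eq_cvg; apply: nearW => n /=.
  rewrite -(@locint_integral _ (fun y => h y * eta n y)); last first.
    by move=> y hy; rewrite eta_out ?mulr0.
  rewrite -hwh; last exact: test_function_intro (seta n) (eta_out n).
  rewrite (has_derivativeE (heta n)).
  have iwk x : mu.-integrable setT (EFin \o (fun y => w y * step_kernel rho (k n) x y)).
    apply: (@locint_integrable _ _ x (x + (k n)^-1)).
      by apply: locintM => //; exact: kernel_continuous step _ _.
    by move=> y hy; rewrite (kernel_out step (k0 n) hy) mulr0.
  rewrite -RintegralB//; apply: eq_Rintegral => y _.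
  by rewrite mulN1r mulrBr.
have e := cvg_unique (@Rhausdorff R) (cvgN cvg_int) cvg_int'.
by rewrite -[RHS]opprK e opprB.
Unshelve. all: by end_near. Qed.

Lemma primitive_of_weak_derivative w h : locint w -> locint h ->
  (forall eta, test_function eta ->
    \int[mu]_x (w x * derive1 eta x) = - \int[mu]_x (h x * eta x)) ->
  exists C, {ae mu, forall x, w x = C + primitive h x}.
Proof.
move=> lw lh hwh.
have leb := lebesgue_differentiation lw.
have [a _ wa] := ae_exists leb ltr01.
exists (w a - primitive h a); apply: aeS leb => x wx.
have key (u v : R) : lebesgue_pt w u -> lebesgue_pt w v -> u < v ->
    w v - w u = primitive h v - primitive h u.
  move=> wu wv uv; rewrite primitiveB ?ltW//.
  exact: increment_of_weak_derivative hwh wu wv uv.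
have [ax|xa|->] := ltgtP a x.
- by have := key _ _ wa wx ax; lra.
- by have := key _ _ wx wa xa; lra.
- by rewrite subrK.
Qed.

(** Affine functions are those with vanishing second differences.  Take
    two Lebesgue points [a] < [b] and a third one [x]: the combination of the point
    masses at [a], [x], [b] that kills affine functions is the limit of second
    derivatives of smooth tents, which have compact support for that very reason. *)
Lemma affine_of_weak w : locint w ->
  (forall eta, test_function eta -> \int[mu]_x (w x * derive1n 2 eta x) = 0) ->
  exists A B, {ae mu, forall x, w x = A + B * x}.
Proof.
move=> lw hw; have [rho [Phi [Psi step]]] := @smooth_step_exists R.
have leb := lebesgue_differentiation lw.
have [a /andP[_ a1] wa] := ae_exists leb ltr01.
have [b /andP[b1 _] wb] := ae_exists leb (ltr_nat R 1 2).
have ab : a < b := lt_trans a1 b1.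
(* The affine function is the chord of w between a and b. *)
exists ((b * w a - a * w b) / (b - a)), ((w b - w a) / (b - a)).
apply: aeS leb => x wx.
suff : (b - x) * w a + - (b - a) * w x + (x - a) * w b = 0.
  move=> e; have ba0 : b - a != 0 by rewrite subr_eq0 gt_eqF.
  apply: (mulfI ba0).
  rewrite [RHS](_ : _ = b * w a - a * w b + (w b - w a) * x); last by field.
  by move: e; lra.
pose k n : R := n.+1%:R.
have k0 n : 0 < k n by rewrite /k ltr0n.
have ki1 n : (k n)^-1 <= 1 by rewrite invf_le1// /k ler1n.
pose s n x y := (k n)^-1 * Psi (k n * y + - (k n * x)).
pose c3 (f : R -> R -> R) y := (b - x) * f a y + - (b - a) * f x y + (x - a) * f b y.
pose eta n := c3 (s n).
have hc3 (f df : R -> R -> R) : (forall x, has_derivative (f x) (df x)) ->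
    has_derivative (c3 f) (c3 df).
  move=> hf; apply: has_derivativeD; last exact: has_derivativeZ.
  by apply: has_derivativeD; exact: has_derivativeZ.
have heta n : has_derivative (eta n) (c3 (fun x y => Phi (k n * y + - (k n * x)))).
  apply: hc3 => z.
  apply: has_derivative_ext (has_derivativeZ (k n)^-1
    (has_derivative_affine (k n) _ (step_derivative2 step))) _ => y.
  by rewrite mulKf// gt_eqF.
have heta2 n : has_derivative (c3 (fun x y => Phi (k n * y + - (k n * x))))
    (c3 (step_kernel rho (k n))).
  by apply: hc3 => z; exact: has_derivative_affine (step_derivative step).
have seta n : smooth (eta n).
  apply: has_derivative_smooth (heta n) _.
  apply: has_derivative_smooth (heta2 n) _.
  have sk z : smooth (step_kernel rho (k n) z).
    exact: (@smoothZ R _ _ (@smooth_affine R rho _ _ (step_smooth step))).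
  exact: (@smoothD R _ _ (@smoothD R _ _ (@smoothZ R _ _ (sk a))
    (@smoothZ R _ _ (sk x))) (@smoothZ R _ _ (sk b))).
have s_left n z y : y <= z -> s n z y = 0.
  by move=> yz; rewrite /s (step_left2 step) ?mulr0// -mulrBr pmulr_rle0 ?subr_le0.
have [m hm] := step_right2 step.
have s_right n z y : z + (k n)^-1 <= y -> s n z y = y - z - m / k n.
  move=> yz; rewrite /s hm; last first.
    by rewrite -mulrBr mulrC -ler_pdivrMr// mul1r lerBrDl.
  by field; rewrite gt_eqF.
pose lo := Num.min a x; pose hi := Num.max b x + 1.
have eta_out n y : ~~ (lo <= y <= hi) -> eta n y = 0.
  rewrite negb_and -!ltNge /eta /c3 /lo /hi => /orP[|yb].
    rewrite lt_min => /andP[ya yx].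
    rewrite (s_left _ a) ?(s_left _ x) ?(s_left _ b) ?mulr0 ?addr0 ?ltW//.
    exact: lt_trans ab.
  have hz z : z <= Num.max b x -> z + (k n)^-1 <= y.
    by move=> zb; rewrite (le_trans (lerD zb (ki1 n)))// ltW.
  (* To the right of all three points the corners are affine with the same offset m,
     and the coefficients annihilate affine functions. *)
  rewrite !s_right ?hz ?le_max ?lexx ?orbT ?(ltW ab)//.
  by ring.
pose W n z := \int[mu]_y (w y * step_kernel rho (k n) z y).
have cW z : lebesgue_pt w z -> W n z @[n --> \oo] --> w z.
  by move=> wz; exact: (kernel_cvg step lw wz).
have cvgc : ((b - x) * W n a + - (b - a) * W n x + (x - a) * W n b) @[n --> \oo] -->
    (b - x) * w a + - (b - a) * w x + (x - a) * w b.
  by apply: cvgD; [apply: cvgD|]; apply: cvgMr; exact: cW.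
suff W0 : forall n, (b - x) * W n a + - (b - a) * W n x + (x - a) * W n b = 0.
  move: cvgc; under eq_fun do rewrite W0.
  by move/(cvg_unique (@Rhausdorff R)) => /(_ _ (cvg_cst _)).
move=> n.
have := hw _ (test_function_intro (seta n) (eta_out n)).
rewrite derive1nS derive1n1 (has_derivativeE (heta n)) (has_derivativeE (heta2 n)).
move=> <-.
have iwk z : mu.-integrable setT (EFin \o (fun y => w y * step_kernel rho (k n) z y)).
  apply: (@locint_integrable _ _ z (z + (k n)^-1)).
    by apply: locintM => //; exact: kernel_continuous step _ _.
  by move=> y hy; rewrite (kernel_out step (k0 n) hy) mulr0.
have iwc c z : mu.-integrable setT
    (EFin \o (fun y => c * (w y * step_kernel rho (k n) z y))).
  exact: integrableZl (iwk z).
rewrite /W -!RintegralZl// -!RintegralD//; last first.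
  exact: (integrableD _ (iwc _ _) (iwc _ _)).
by apply: eq_Rintegral => y _; rewrite /c3; ring.
Qed.

End DuBoisReymond.

(** * Weak derivatives in L2 *)

Section WeakDerivative.
Context {R : realType}.
Local Notation mu := (@lebesgue_measure R).
Implicit Types f g h w u v eta : R -> R.
Local Notation locint := (locally_integrable [set: R]).

Lemma ae_eq_Rintegral (D : set R) f g : measurable D ->
  measurable_fun setT f -> measurable_fun setT g ->
  {ae mu, forall x, f x = g x} ->
  \int[mu]_(x in D) f x = \int[mu]_(x in D) g x.
Proof.
move=> mD mf mg fg; rewrite /Rintegral; congr fine.
apply: ae_eq_integral => //.
- by apply/measurable_EFinP; exact: measurable_funS mf.
- by apply/measurable_EFinP; exact: measurable_funS mg.
- by apply: aeS fg => x -> _.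
Qed.

Lemma ae_eq_integrable f g : measurable_fun setT f -> measurable_fun setT g ->
  {ae mu, forall x, f x = g x} ->
  mu.-integrable setT (EFin \o f) -> mu.-integrable setT (EFin \o g).
Proof.
move=> mf mg fg /integrableP[_ fi]; apply/integrableP; split.
  exact/measurable_EFinP.
rewrite (@ae_eq_integral _ _ R mu setT (fun x => `|(f x)%:E|%E))//.
- by apply: measurableT_comp => //; exact/measurable_EFinP.
- by apply: measurableT_comp => //; exact/measurable_EFinP.
- by apply: aeS fg => x /= -> _.
Qed.

Lemma in_L2_of_sqr u : measurable_fun setT u ->
  mu.-integrable setT (EFin \o (fun x => u x ^+ 2)) -> in_L2 u.
Proof.
move=> mfu /integrableP[_ iu]; rewrite /in_L2 inE; apply/andP; split; rewrite inE//=.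
rewrite /finite_norm unlock /Lnorm poweR_lty//.
rewrite (_ : (fun x => _) = (fun x => `|(u x ^+ 2)%:E|%E))//.
by apply/funext => x; rewrite /= normrX powR_mulrn.
Qed.

Lemma in_L2_integrable_sqr u : in_L2 u ->
  mu.-integrable setT (EFin \o (fun x => u x ^+ 2)).
Proof. exact: Lfun2_integrable_sqr. Qed.

Lemma in_L2_integrableM u v : in_L2 u -> in_L2 v ->
  mu.-integrable setT (EFin \o (fun x => u x * v x)).
Proof. by move=> u2 v2; exact/Lfun1_integrable/Lfun2_mul_Lfun1. Qed.

Lemma ae_eq_in_L2 u v : {ae mu, forall x, u x = v x} -> measurable_fun setT v ->
  in_L2 u -> in_L2 v.
Proof.
move=> uv mv u2; have mfu := in_L2_measurable u2.
apply: in_L2_of_sqr => //.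
apply: ae_eq_integrable (in_L2_integrable_sqr u2).
- exact: measurable_funX.
- exact: measurable_funX.
- by apply: aeS uv => x ->.
Qed.

Lemma in_L2Z k u : in_L2 u -> in_L2 (fun x => k * u x).
Proof.
move=> u2; apply: in_L2_of_sqr.
  by apply: measurable_funM => //; exact: in_L2_measurable.
under eq_fun do rewrite exprMn.
exact: integrableZl (in_L2_integrable_sqr u2).
Qed.

Lemma in_L2D u v : in_L2 u -> in_L2 v -> in_L2 (fun x => u x + v x).
Proof.
move=> u2 v2; apply: in_L2_of_sqr.
  by apply: measurable_funD; exact: in_L2_measurable.
have h : mu.-integrable setT (fun x => ((u x ^+ 2)%:E + (2%:E * (u x * v x)%:E)) + (v x ^+ 2)%:E)%E.
  apply: integrableD => //; last exact: in_L2_integrable_sqr.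
  apply: integrableD => //; first exact: in_L2_integrable_sqr.
  apply: integrableZl => //; exact: in_L2_integrableM.
apply: eq_integrable h => // x _ /=; congr EFin; ring.
Qed.

Lemma test_function_continuous eta : test_function eta -> continuous eta.
Proof. by move=> te; exact: smooth_continuous te.1. Qed.

Lemma test_function_derive1n j eta : test_function eta -> test_function (derive1n j eta).
Proof.
by move=> te; elim: j => [//|j IH]; rewrite derive1nS; exact: test_function_derive1.
Qed.

Lemma pairing_integrable w eta : locint w -> test_function eta ->
  mu.-integrable setT (EFin \o (fun x => w x * eta x)).
Proof.
move=> lw te; have [M _ hM] := test_function_support te.
apply: (@locint_integrable _ _ (- M) M).
  by apply: locintM => //; exact: test_function_continuous.
by move=> x /hM ->; rewrite mulr0.
Qed.

Lemma test_function_in_L2 eta : test_function eta -> in_L2 eta.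
Proof.
move=> te; have ce := test_function_continuous te; apply: in_L2_of_sqr.
  exact: continuous_measurable_fun.
exact: pairing_integrable (continuous_locint ce) te.
Qed.

Lemma by_parts f df eta : has_derivative f df -> continuous df -> test_function eta ->
  \int[mu]_x (f x * derive1 eta x) = - \int[mu]_x (df x * eta x).
Proof.
move=> hf cdf te; have [M M0 hM] := test_function_support te.
have te' := test_function_derive1 te.
have cf := has_derivative_continuous hf.
have he := smooth_has_derivative te.1.
have i1 := pairing_integrable (continuous_locint cf) te'.
have i2 := pairing_integrable (continuous_locint cdf) te.
apply/eqP; rewrite -subr_eq0 opprK addrC -RintegralD//.
have hfe := has_derivativeM hf he.
have M1 : M < M + 1 by rewrite ltrDl.
have out x : ~~ (- (M + 1) <= x <= M + 1) ->
    df x * eta x + f x * derive1 eta x = 0.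
  move=> hx; have hx' : ~~ (- M <= x <= M).
    apply: contra hx => /andP[x1 x2]; apply/andP; split; lra.
  rewrite hM// mulr0 add0r.
  suff -> : derive1 eta x = 0 by rewrite mulr0.
  exact: derive1_outside hM _ hx'.
rewrite (locint_integral out) (FTC2 hfe).
- rewrite (hM (M + 1)) ?(hM (- (M + 1))) ?mulr0 ?subrr//.
    by rewrite negb_and -!ltNge; apply/orP; left; lra.
  by rewrite negb_and -!ltNge; apply/orP; right; lra.
- move=> x; apply: cvgD; apply: cvgM; [exact: cdf|exact: test_function_continuous|exact: cf|].
  exact: test_function_continuous.
- lra.
Qed.

(** Classical and weak derivatives agree, so the maximizer can be perturbed
    by test functions. *)
Lemma test_function_weak_derivative j eta : test_function eta ->
  is_weak_derivative j eta (derive1n j eta).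
Proof.
move=> te; split.
- exact: test_function_in_L2.
- exact/test_function_in_L2/test_function_derive1n.
- elim: j eta te => [|j IH] eta te xi txi.
    by rewrite expr0 mul1r.
  rewrite derive1nS (by_parts (smooth_has_derivative te.1)) //.
  + rewrite IH//; last exact: test_function_derive1.
    by rewrite derive1nSr exprS mulN1r mulNr.
  + exact/test_function_continuous/test_function_derive1.
  + exact: test_function_derive1n.
Qed.

Lemma is_weak_derivativeZ j k u v : is_weak_derivative j u v ->
  is_weak_derivative j (fun x => k * u x) (fun x => k * v x).
Proof.
move=> [u2 v2 uv]; split; [exact: in_L2Z..|move=> eta te].
have Z w f : locint w -> test_function f ->
    \int[mu]_x (k * w x * f x) = k * \int[mu]_x (w x * f x).
  move=> lw tf; rewrite -RintegralZl//; last exact: pairing_integrable.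
  by apply: eq_Rintegral => x _; rewrite mulrA.
rewrite !Z//; [|exact: in_L2_locint|exact: in_L2_locint|exact: test_function_derive1n].
by rewrite uv// mulrCA.
Qed.

Lemma is_weak_derivativeD j u v u' v' :
  is_weak_derivative j u v -> is_weak_derivative j u' v' ->
  is_weak_derivative j (fun x => u x + u' x) (fun x => v x + v' x).
Proof.
move=> [u2 v2 uv] [u2' v2' uv']; split; [exact: in_L2D..|move=> eta te].
have D w w' f : locint w -> locint w' -> test_function f ->
    \int[mu]_x ((w x + w' x) * f x) = \int[mu]_x (w x * f x) + \int[mu]_x (w' x * f x).
  move=> lw lw' tf; rewrite -RintegralD//; try exact: pairing_integrable.
  by apply: eq_Rintegral => x _; rewrite mulrDl.
rewrite !D//; try exact: in_L2_locint; try exact: test_function_derive1n.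
by rewrite uv// uv'// mulrDr.
Qed.

Lemma is_weak_derivative_unique j u v v' :
  is_weak_derivative j u v -> is_weak_derivative j u v' ->
  {ae mu, forall x, v x = v' x}.
Proof.
move=> [_ /in_L2_locint lv uv] [_ /in_L2_locint lv' uv'].
have : {ae mu, forall x, v x - v' x = 0}.
  apply: ae_zero_of_weak; first exact: locintB.
  move=> eta te.
  rewrite (_ : (fun x => _) = (fun x => v x * eta x - v' x * eta x)); last first.
    by apply/funext => x; rewrite mulrBl.
  rewrite RintegralB//; try exact: pairing_integrable.
  apply/eqP; rewrite subr_eq0; apply/eqP.
  apply: (@mulfI _ ((-1) ^+ j)); first by rewrite signr_eq0.
  by rewrite -uv// -uv'.
by apply: aeS => x /eqP; rewrite subr_eq0 => /eqP.
Qed.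

Lemma in_H_weak_derivative m j u : in_H m u -> (j <= m)%N ->
  is_weak_derivative j u (weak_derivative j u).
Proof.
move=> hu jm; rewrite /weak_derivative.
by have := @xgetPex _ (cst 0) [set v | is_weak_derivative j u v] (hu j jm).
Qed.

Lemma in_H2_intro u v1 v2 : is_weak_derivative 1 u v1 -> is_weak_derivative 2 u v2 ->
  in_H 2 u.
Proof.
move=> h1 h2; case=> [|[|[|//]]] _; [|by exists v1|by exists v2].
exists u; case: h1 => u2 _ _; split => // eta te.
by rewrite expr0 mul1r.
Qed.

Lemma ae_eq_is_weak_derivative j u u' v : {ae mu, forall x, u x = u' x} ->
  measurable_fun setT u' -> is_weak_derivative j u v -> is_weak_derivative j u' v.
Proof.
move=> uu' mfu [u2 v2 uv]; split => //; first exact: ae_eq_in_L2 uu' _ u2.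
move=> eta te; rewrite -uv//; apply: ae_eq_Rintegral => //.
- apply: measurable_funM => //.
  by apply: continuous_measurable_fun; exact/test_function_continuous/test_function_derive1n.
- apply: measurable_funM; first exact: in_L2_measurable.
  by apply: continuous_measurable_fun; exact/test_function_continuous/test_function_derive1n.
- by apply: aeS uu' => x ->.
Qed.

(** The first weak derivative of [u] is itself a primitive of [v2], hence
    continuous after modification on a null set; integrating it again gives [psi].
    The equation for [psi1] is kept since it becomes a differential equation as
    soon as [v2] is known to be continuous. *)
Lemma H2_representative u : in_H 2 u -> exists psi psi1 v2 C,
  [/\ has_derivative psi psi1, {ae mu, forall x, u x = psi x},
      is_weak_derivative 1 psi psi1, is_weak_derivative 2 psi v2 &
      forall x, psi1 x = C + primitive v2 x].
Proof.
move=> hu; have /= h1 := in_H_weak_derivative hu (isT : (1 <= 2)%N).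
have /= h2 := in_H_weak_derivative hu (isT : (2 <= 2)%N).
move: (weak_derivative 1 u) (weak_derivative 2 u) h1 h2 => v1 v2 h1 h2.
have lu : locint u by case: h1 => /in_L2_locint.
have lv1 : locint v1 by case: h1 => _ /in_L2_locint.
have lv2 : locint v2 by case: h2 => _ /in_L2_locint.
have [C0 hC0] : exists C, {ae mu, forall x, u x = C + primitive v1 x}.
  apply: primitive_of_weak_derivative => // eta te.
  by case: h1 => _ _ /(_ eta te); rewrite expr1 mulN1r.
have [C1 hC1] : exists C, {ae mu, forall x, v1 x = C + primitive v2 x}.
  apply: primitive_of_weak_derivative => // eta te.
  case: h1 => _ _ /(_ _ (test_function_derive1 te)).
  case: h2 => _ _ /(_ eta te); rewrite sqrrN expr1n mul1r => <-.
  by rewrite expr1 mulN1r => ->; rewrite opprK.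
pose psi1 x := C1 + primitive v2 x.
have cpsi1 : continuous psi1.
  by move=> x; apply: cvgD; [exact: cvg_cst|exact: primitive_continuous].
pose psi x := C0 + primitive psi1 x.
have hpsi : has_derivative psi psi1.
  apply: has_derivative_ext (has_derivativeD (has_derivative_cst C0)
    (primitive_derivative cpsi1)) _ => x.
  by rewrite add0r.
have mpsi : measurable_fun setT psi.
  by apply: continuous_measurable_fun; exact: (has_derivative_continuous hpsi).
have mpsi1 : measurable_fun setT psi1 by exact: continuous_measurable_fun.
have upsi : {ae mu, forall x, u x = psi x}.
  apply: aeS hC0 => x ->; rewrite /psi; congr (_ + _).
  by rewrite /primitive; congr (_ - _); apply: ae_eq_Rintegral => //;
    exact: locint_measurable lv1.
exists psi, psi1, v2, C1; split => //.
- case: (ae_eq_is_weak_derivative upsi mpsi h1) => psi2 v12 e; split => //.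
    exact: ae_eq_in_L2 v12.
  move=> eta te; rewrite e//; congr (_ * _); apply: ae_eq_Rintegral => //.
  + apply: measurable_funM; first exact: locint_measurable lv1.
    by apply: continuous_measurable_fun; exact: test_function_continuous.
  + apply: measurable_funM => //.
    by apply: continuous_measurable_fun; exact: test_function_continuous.
  + by apply: aeS hC1 => x ->.
- exact: ae_eq_is_weak_derivative h2.
Qed.

End WeakDerivative.

(** * Vanishing at infinity *)

Section Vanishing.
Context {R : realType}.
Local Notation mu := (@lebesgue_measure R).
Implicit Types psi dpsi E : R -> R.

(** E + psi^2 is nondecreasing, so psi^2 cannot drop by more than the bounded
    monotone function E increases.  If psi were not small far out, it would
    stay away from 0 afterwards and make E grow linearly. *)
Lemma vanish_right psi (psi1 : R -> R) E K e : has_derivative psi psi1 ->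
  has_derivative E (fun x => psi x ^+ 2 + psi1 x ^+ 2) ->
  (forall x, E x <= K) -> 0 < e ->
  exists2 X, 0 <= X & forall x, X <= x -> `|psi x| <= e.
Proof.
move=> hpsi hE EK e0.
have E_homo x y : x <= y -> E x <= E y.
  move=> xy; apply: (has_derivative_nondecreasing hE) xy => // t _.
  by rewrite addr_ge0// sqr_ge0.
have hS : has_sup (range E).
  by split; [exists (E 0); exists 0|exists K => _ [x _ <-]].
have e20 : 0 < e ^+ 2 / 2 by rewrite divr_gt0// exprn_gt0.
have [_ [t _ <-] supE] := sup_adherent e20 hS.
exists (Num.max t 0); first by rewrite le_max lexx orbT.
move=> x; rewrite ge_max => /andP[tx _]; rewrite leNgt; apply/negP => pe.
have cauchy y : x <= y -> E y - E x <= e ^+ 2 / 2.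
  move=> xy; have : E y <= sup (range E) by apply: ub_le_sup; [case: hS|exists y].
  by have := E_homo _ _ tx; lra.
have hsum : has_derivative (fun x => psi x ^+ 2 + E x)
    (fun x => 2 * psi x * psi1 x + (psi x ^+ 2 + psi1 x ^+ 2)).
  exact: has_derivativeD (has_derivative_sqr hpsi) hE.
have px : e ^+ 2 < psi x ^+ 2.
  by rewrite -[psi x ^+ 2]real_normK ?num_real// ltr_sqr ?nnegrE// ltW.
have large y : x <= y -> e ^+ 2 / 2 < psi y ^+ 2.
  move=> xy; have : psi x ^+ 2 + E x <= psi y ^+ 2 + E y.
    apply: (has_derivative_nondecreasing hsum) xy => // s _.
    by have := sqr_ge0 (psi s + psi1 s); rewrite !expr2; lra.
  by have := cauchy _ xy; lra.
have xx2 : x <= x + 2 by rewrite lerDl.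
have [s /andP[xs _] es] := has_derivative_MVT hE xx2.
have := cauchy _ xx2; have := large s xs; have := sqr_ge0 (psi1 s).
by rewrite es; lra.
Qed.

(** Apply [vanish_right] to a primitive E of psi^2 + psi1^2, which is bounded by
    the integral of that density; the left half-line follows by reflection. *)
Lemma H1_vanishing psi (psi1 : R -> R) : has_derivative psi psi1 -> continuous psi1 ->
  in_L2 psi -> in_L2 psi1 ->
  (exists B, forall x, `|psi x| <= B) /\
  (forall e, 0 < e -> exists2 X, 0 <= X & forall x, X <= `|x| -> `|psi x| <= e).
Proof.
move=> hpsi cpsi1 psi2 psi12; pose h x := psi x ^+ 2 + psi1 x ^+ 2.
have cpsi := has_derivative_continuous hpsi.
have ch : continuous h.
  by move=> x; apply: cvgD; apply: cvgM; [exact: cpsi|exact: cpsi|exact: cpsi1|exact: cpsi1].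
have h0 x : 0 <= h x by rewrite addr_ge0// sqr_ge0.
have ih : mu.-integrable setT (EFin \o h).
  exact: (integrableD measurableT (in_L2_integrable_sqr psi2)
    (in_L2_integrable_sqr psi12)).
pose E := primitive h; have hE : has_derivative E h by exact: primitive_derivative.
pose J := \int[mu]_x h x.
have EJ x y : x <= y -> E y - E x <= J.
  move=> xy; rewrite -(FTC2 hE ch xy) /J [leLHS]Rintegral_mkcond.
  apply: le_Rintegral => //.
    by rewrite -restrict_EFin -integrable_mkcond//; exact: integrableS ih.
  by move=> z _; rewrite patchE; case: ifP.
split.
  have hm : has_derivative (fun x => E x - psi x ^+ 2)
      (fun x => h x - 2 * psi x * psi1 x).
    exact: has_derivativeB hE (has_derivative_sqr hpsi).
  have hp : has_derivative (fun x => psi x ^+ 2 + E x)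
      (fun x => 2 * psi x * psi1 x + h x).
    exact: has_derivativeD (has_derivative_sqr hpsi) hE.
  have sq x : psi x ^+ 2 <= psi 0 ^+ 2 + J.
    have [x0|x0] := leP 0 x.
      have : E 0 - psi 0 ^+ 2 <= E x - psi x ^+ 2.
        apply: (has_derivative_nondecreasing hm) x0 => // s _.
        by have := sqr_ge0 (psi s - psi1 s); rewrite /h !expr2; lra.
      by have := EJ _ _ x0; lra.
    have : psi x ^+ 2 + E x <= psi 0 ^+ 2 + E 0.
      apply: (has_derivative_nondecreasing hp) (ltW x0) => // s _.
      by have := sqr_ge0 (psi s + psi1 s); rewrite /h !expr2; lra.
    by have := EJ _ _ (ltW x0); lra.
  exists (psi 0 ^+ 2 + J + 1) => x.
  have K0 : 0 <= psi 0 ^+ 2 + J by exact: le_trans (sqr_ge0 _) (sq x).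
  rewrite -ler_sqr ?nnegrE ?(addr_ge0 K0)//.
  rewrite real_normK ?num_real// (le_trans (sq x))//.
  by have := sqr_ge0 (psi 0 ^+ 2 + J); rewrite !expr2; lra.
move=> e e0.
have [|X1 X10 h1] := vanish_right hpsi hE (K := E 0 + J) _ e0.
  move=> x; have [x0|x0] := leP 0 x; first by have := EJ _ _ x0; lra.
  have J0 : 0 <= J by exact: Rintegral_ge0.
  have : E x <= E 0.
    by apply: (has_derivative_nondecreasing hE) (ltW x0).
  lra.
have hE' : has_derivative (fun x => - E (- x))
    (fun x => psi (- x) ^+ 2 + (- psi1 (- x)) ^+ 2).
  have /(has_derivativeZ (-1)) hh := has_derivative_reflect hE.
  move=> x; have := hh x; rewrite mulrNN mul1r sqrrN.
  by under eq_fun do rewrite mulN1r.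
have [|X2 X20 h2] := vanish_right (has_derivative_reflect hpsi) hE' (K := J - E 0) _ e0.
  move=> x; have [x0|x0] := leP 0 x.
    have nx : - x <= 0 by rewrite oppr_le0.
    by have := EJ _ _ nx; lra.
  have J0 : 0 <= J by exact: Rintegral_ge0.
  have : E 0 <= E (- x).
    by apply: (has_derivative_nondecreasing hE) => //; rewrite oppr_ge0 ltW.
  lra.
exists (Num.max X1 X2); first by rewrite le_max X10.
move=> x; rewrite ge_max => /andP[x1 x2].
have [x0|x0] := leP 0 x; first by apply: h1; rewrite -(ger0_norm x0).
by rewrite -[x]opprK; apply: h2; rewrite -(ltr0_norm x0).
Qed.

End Vanishing.

(** * Convexity of the nonlinear functional *)

Section EulerLagrange.
Context {R : realType}.
Local Notation mu := (@lebesgue_measure R).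
Implicit Types u v w psi eta : R -> R.
Local Notation locint := (locally_integrable [set: R]).

Definition nonlinearity (N : nat) (a : nat -> R) (r : R) : R :=
  \sum_(1 <= k < N.+1) a k * r ^+ k.

(** Convexity of powers on the nonnegative half-line; each step of the
    induction costs the square (y - x)^2 times a nonnegative factor. *)
Lemma exprn_tangent k (x y : R) : 0 <= x -> 0 <= y ->
  x ^+ k.+1 + k.+1%:R * x ^+ k * (y - x) <= y ^+ k.+1.
Proof.
move=> x0 y0; elim: k => [|k IH]; first by rewrite !expr1 expr0; lra.
have h1 : y * (x ^+ k.+1 + k.+1%:R * x ^+ k * (y - x)) <= y * y ^+ k.+1.
  by rewrite ler_wpM2l.
rewrite [leRHS]exprS (le_trans _ h1)// -subr_ge0.
rewrite (_ : _ - _ = k.+1%:R * x ^+ k * (y - x) ^+ 2); last first.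
  by rewrite !exprS -[in X in _ - X]natr1; ring.
by rewrite mulr_ge0 ?sqr_ge0// mulr_ge0// exprn_ge0.
Qed.

Variables (N : nat) (a : nat -> R).
Hypothesis a_ge0 : forall k : nat, (1 <= k <= N)%N -> 0 <= a k.

Local Notation F := (nonlinearity N a).

Lemma nonlinearity_ge0 r : 0 <= r -> 0 <= F r.
Proof.
move=> r0; rewrite /nonlinearity big_nat; apply: sumr_ge0 => k hk.
by rewrite mulr_ge0 ?exprn_ge0// a_ge0.
Qed.

Lemma G_tangent (x y : R) : 0 <= x -> 0 <= y -> G N a x + F x * (y - x) <= G N a y.
Proof.
move=> x0 y0; rewrite /G /nonlinearity mulr_suml -big_split/=.
rewrite !big_nat; apply: ler_sum => k hk.
have k0 : k.+1%:R != 0 :> R by rewrite pnatr_eq0.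
rewrite (_ : _ + _ = a k / k.+1%:R * (x ^+ k.+1 + k.+1%:R * x ^+ k * (y - x))); last by field.
by rewrite ler_wpM2l ?divr_ge0 ?a_ge0// exprn_tangent.
Qed.

Lemma G_sqr_tangent (x y : R) :
  G N a (`|x| ^+ 2) + 2 * (F (x ^+ 2) * x * (y - x)) <= G N a (`|y| ^+ 2).
Proof.
rewrite !real_normK ?num_real//.
apply: le_trans (G_tangent (sqr_ge0 x) (sqr_ge0 y)); rewrite lerD2l.
rewrite (_ : 2 * _ = F (x ^+ 2) * (2 * x * (y - x))); last by ring.
rewrite ler_wpM2l ?nonlinearity_ge0 ?sqr_ge0//.
by have := sqr_ge0 (y - x); rewrite !expr2; lra.
Qed.

Lemma bounded_mul_integrable u v K : measurable_fun setT u ->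
  (forall x, `|u x| <= K) -> mu.-integrable setT (EFin \o v) ->
  mu.-integrable setT (EFin \o (fun x => u x * v x)).
Proof.
move=> mfu uK iv.
have iKv : mu.-integrable setT (fun x => K%:E * (v x)%:E)%E by exact: integrableZl.
have mv : measurable_fun setT v.
  by apply/measurable_EFinP; exact: measurable_int iv.
apply: le_integrable iKv => //.
  by apply/measurable_EFinP; exact: measurable_funM.
move=> x _ /=; rewrite lee_fin !normrM ler_wpM2r//.
by rewrite (le_trans (uK x))// ler_norm.
Qed.

Lemma measurable_sum_powers (b : nat -> R) (d : nat -> nat) (s : seq nat) u :
  measurable_fun setT u ->
  measurable_fun setT (fun x => \sum_(k <- s) b k * u x ^+ d k).
Proof.
move=> mfu; apply: measurable_sum => k; apply: measurable_funM => //.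
exact: measurable_funX.
Qed.

Lemma sum_powers_bounded (b : nat -> R) (d : nat -> nat) (s : seq nat) u B :
  (forall x, `|u x| <= B) ->
  exists K, forall x, `|\sum_(k <- s) b k * u x ^+ d k| <= K.
Proof.
move=> uB; exists (\sum_(k <- s) `|b k| * B ^+ d k) => x.
rewrite (le_trans (ler_norm_sum _ _ _))//; apply: ler_sum => k _.
by rewrite normrM normrX ler_wpM2l// lerXn2r// nnegrE (le_trans _ (uB x)).
Qed.

Lemma nonlinearity_sqr u x :
  F (u x ^+ 2) = \sum_(k <- index_iota 1 N.+1) a k * u x ^+ (2 * k).
Proof. by apply: eq_bigr => k _; rewrite exprM. Qed.

Lemma G_sqr u x :
  G N a (`|u x| ^+ 2) =
  (\sum_(k <- index_iota 1 N.+1) a k / k.+1%:R * u x ^+ (2 * k)) * u x ^+ 2.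
Proof.
rewrite real_normK ?num_real// /G mulr_suml; apply: eq_bigr => k _.
by rewrite exprS exprM; ring.
Qed.

Lemma G_integrable u B : in_L2 u -> (forall x, `|u x| <= B) ->
  mu.-integrable setT (EFin \o (fun x => G N a (`|u x| ^+ 2))).
Proof.
move=> u2 uB; have mfu := in_L2_measurable u2.
have [K hK] := sum_powers_bounded (fun k => a k / k.+1%:R) (fun k => 2 * k)%N
  (index_iota 1 N.+1) uB.
under eq_fun do rewrite G_sqr.
apply: (bounded_mul_integrable (K := K)) => //.
- exact: measurable_sum_powers.
- exact: in_L2_integrable_sqr.
Qed.

Lemma nonlinearity_in_L2 u B : in_L2 u -> (forall x, `|u x| <= B) ->
  in_L2 (fun x => F (u x ^+ 2) * u x).
Proof.
move=> u2 uB; have mfu := in_L2_measurable u2.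
have [K hK] := sum_powers_bounded a (fun k => 2 * k)%N (index_iota 1 N.+1) uB.
under eq_fun do rewrite nonlinearity_sqr.
have mF := measurable_sum_powers a (fun k => 2 * k)%N (index_iota 1 N.+1) mfu.
apply: in_L2_of_sqr; first exact: measurable_funM.
under eq_fun do rewrite exprMn.
apply: (bounded_mul_integrable (K := K ^+ 2)); last exact: in_L2_integrable_sqr.
  exact: measurable_funX.
move=> x; rewrite normrX lerXn2r// nnegrE (le_trans _ (hK x))//.
Qed.

(** Since I is convex, maximality of [psi] only has to be compared with the
    first order term, and no derivative of I along a curve is needed. *)
Lemma I_functional_tangent u psi B B' : in_L2 u -> (forall x, `|u x| <= B) ->
  in_L2 psi -> (forall x, `|psi x| <= B') ->
  I_functional N a psi +
    2 * \int[mu]_x (F (psi x ^+ 2) * psi x * (u x - psi x)) <= I_functional N a u.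
Proof.
move=> u2 uB p2 pB; rewrite /I_functional.
have iG := G_integrable p2 pB.
have il : mu.-integrable setT
    (EFin \o (fun x => F (psi x ^+ 2) * psi x * (u x - psi x))).
  apply: (in_L2_integrableM (nonlinearity_in_L2 p2 pB)).
  rewrite (_ : (fun x => _) = (fun x => u x + -1 * psi x)); last first.
    by apply/funext => x; rewrite mulN1r.
  by apply: in_L2D => //; exact: in_L2Z.
have il2 : mu.-integrable setT
    (EFin \o (fun x => 2 * (F (psi x ^+ 2) * psi x * (u x - psi x)))).
  exact: integrableZl il.
rewrite -RintegralZl// -RintegralD//.
apply: le_Rintegral => //.
- exact: (integrableD _ iG il2).
- exact: G_integrable uB.
- by move=> x _; exact: G_sqr_tangent.
Qed.

End EulerLagrange.

(** * The Euler-Lagrange equation *)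

Section WeakEquation.
Context {R : realType}.
Local Notation mu := (@lebesgue_measure R).
Implicit Types u v w psi eta : R -> R.
Local Notation locint := (locally_integrable [set: R]).

(** The density of the symmetric bilinear form whose quadratic form is L; a
    function is passed together with its first two derivatives. *)
Definition energy_density (c : R) (u u1 u2 w w1 w2 : R -> R) (x : R) : R :=
  u2 x * w2 x - c ^+ 2 * (u1 x * w1 x) + u x * w x.

Lemma energy_density_integrable c (u u1 u2 w w1 w2 : R -> R) :
  in_L2 u -> in_L2 u1 -> in_L2 u2 -> in_L2 w -> in_L2 w1 -> in_L2 w2 ->
  mu.-integrable setT (EFin \o energy_density c u u1 u2 w w1 w2).
Proof.
move=> hu hu1 hu2 hw hw1 hw2.
have h1 : mu.-integrable setT (EFin \o (fun x => c ^+ 2 * (u1 x * w1 x))).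
  exact: (integrableZl _ _ (in_L2_integrableM hu1 hw1)).
exact: (integrableD measurableT
  (integrableB measurableT (in_L2_integrableM hu2 hw2) h1)
  (in_L2_integrableM hu hw)).
Qed.

(** L does not depend on the chosen representatives of the weak derivatives. *)
Lemma L_functionalE c (u u1 u2 : R -> R) :
  is_weak_derivative 1 u u1 -> is_weak_derivative 2 u u2 ->
  L_functional c u = \int[mu]_x energy_density c u u1 u2 u u1 u2 x.
Proof.
move=> h1 h2; have hu := in_H2_intro h1 h2.
have w1 := in_H_weak_derivative hu (isT : (1 <= 2)%N).
have w2 := in_H_weak_derivative hu (isT : (2 <= 2)%N).
have e1 := is_weak_derivative_unique w1 h1.
have e2 := is_weak_derivative_unique w2 h2.
have mL2 j v (h : is_weak_derivative j u v) : measurable_fun setT v.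
  by case: h => _ /in_L2_measurable.
have mu0 : measurable_fun setT u by case: h1 => /in_L2_measurable.
have m (v1 v2 : R -> R) : measurable_fun setT v1 -> measurable_fun setT v2 ->
    measurable_fun setT (fun x => v2 x ^+ 2 - c ^+ 2 * v1 x ^+ 2 + u x ^+ 2).
  move=> m1 m2; apply: measurable_funD; last exact: measurable_funX.
  apply: measurable_funB; first exact: measurable_funX.
  by apply: measurable_funM => //; exact: measurable_funX.
rewrite /L_functional (_ : energy_density _ _ _ _ _ _ _ =
    (fun x => u2 x ^+ 2 - c ^+ 2 * u1 x ^+ 2 + u x ^+ 2)); last first.
  by apply/funext => x; rewrite /energy_density !expr2.
apply: ae_eq_Rintegral => //.
- by apply: m; [exact: mL2 w1|exact: mL2 w2].
- by apply: m; [exact: mL2 h1|exact: mL2 h2].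
- by apply: aeS (aeI e1 e2) => x [-> ->].
Qed.

Lemma L_functional_line c s t (u u1 u2 w w1 w2 : R -> R) :
  is_weak_derivative 1 u u1 -> is_weak_derivative 2 u u2 ->
  is_weak_derivative 1 w w1 -> is_weak_derivative 2 w w2 ->
  L_functional c (fun x => s * (u x + t * w x)) =
  s ^+ 2 * (L_functional c u +
            2 * t * \int[mu]_x energy_density c u u1 u2 w w1 w2 x +
            t ^+ 2 * L_functional c w).
Proof.
move=> hu1 hu2 hw1 hw2.
rewrite (L_functionalE c
  (is_weak_derivativeZ s (is_weak_derivativeD hu1 (is_weak_derivativeZ t hw1)))
  (is_weak_derivativeZ s (is_weak_derivativeD hu2 (is_weak_derivativeZ t hw2)))).
rewrite (L_functionalE c hu1 hu2) (L_functionalE c hw1 hw2).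
have [u_2 u1_2 _] := hu1; have [_ u2_2 _] := hu2.
have [w_2 w1_2 _] := hw1; have [_ w2_2 _] := hw2.
have iu := energy_density_integrable c u_2 u1_2 u2_2 u_2 u1_2 u2_2.
have iw := energy_density_integrable c w_2 w1_2 w2_2 w_2 w1_2 w2_2.
have iuw := energy_density_integrable c u_2 u1_2 u2_2 w_2 w1_2 w2_2.
have Z k (f : R -> R) : mu.-integrable setT (EFin \o f) ->
    mu.-integrable setT (EFin \o (fun x => k * f x)).
  exact: integrableZl.
have iA := integrableD measurableT iu (Z (2 * t) _ iuw).
rewrite -(RintegralZl (2 * t) measurableT iuw).
rewrite -(RintegralZl (t ^+ 2) measurableT iw).
rewrite -(RintegralD measurableT iu (Z _ _ iuw)).
rewrite -(RintegralD measurableT iA (Z _ _ iw)).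
rewrite -RintegralZl//; last exact: (integrableD measurableT iA (Z _ _ iw)).
by apply: eq_Rintegral => x _; rewrite /energy_density; ring.
Qed.

(** Here [l + 2 t b + t^2 q] is L along the line psi + t eta and [s] the factor
    that brings it back to the constraint.  Eliminating [s] from the hypothesis
    leaves 2 K t (l m - K b) <= O(t^2) for small [t] of either sign. *)
Lemma lagrange_multiplier (l K m b q : R) : 0 < l -> 0 < K ->
  (forall t s, 0 < s -> s ^+ 2 * (l + 2 * t * b + t ^+ 2 * q) = l ->
    s * (K + t * m) <= K) ->
  l * m = K * b.
Proof.
move=> l0 K0 h; apply/eqP; rewrite -subr_eq0; apply/negPn/negP => d0.
set d := l * m - K * b in d0.
have d2 : 0 < d ^+ 2 by rewrite exprn_even_gt0.
pose P := `|K ^+ 2 * q - l * m ^+ 2|.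
(* The parameter t is tau d, with tau so small that the three inequalities s1, s2, s3
   below hold; the inverse of S is a closed form for such a tau. *)
pose S := 1 + (`|2 * d * b| + `|d ^+ 2 * q|) / l + `|d * m| / K + P / (2 * K).
have x1 : 0 <= (`|2 * d * b| + `|d ^+ 2 * q|) / l.
  by rewrite divr_ge0 ?addr_ge0// ltW.
have x2 : 0 <= `|d * m| / K by rewrite divr_ge0// ltW.
have P0 : 0 <= P by exact: normr_ge0.
have x3 : 0 <= P / (2 * K) by rewrite divr_ge0// mulr_ge0// ltW.
have S0 : 0 < S by rewrite /S; lra.
pose tau := S^-1; have tau0 : 0 < tau by rewrite invr_gt0.
have tau1 : tau <= 1 by rewrite invf_le1// /S; lra.
have small y z : 0 < z -> 0 <= y -> y / z < S -> tau * y < z.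
  move=> z0 y0 yz; rewrite mulrC ltr_pdivrMr// mulrC.
  by rewrite -ltr_pdivrMr.
have s1 : tau * (`|2 * d * b| + `|d ^+ 2 * q|) < l.
  by apply: small; rewrite ?addr_ge0//; rewrite /S; lra.
have s2 : tau * `|d * m| < K by apply: small => //; rewrite /S; lra.
have s3 : tau * P < 2 * K.
  by apply: small => //; [rewrite mulr_gt0|rewrite /S; lra].
pose t := tau * d; pose A := l + 2 * t * b + t ^+ 2 * q.
have A0 : 0 < A.
  have b1 : - `|2 * d * b| <= 2 * d * b by rewrite lerNl -normrN ler_norm.
  have b2 : - `|d ^+ 2 * q| <= d ^+ 2 * q by rewrite lerNl -normrN ler_norm.
  have b3 : tau * - `|2 * d * b| <= tau * (2 * d * b) by rewrite ler_pM2l.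
  have b4 : tau * (tau * - `|d ^+ 2 * q|) <= tau * (tau * (d ^+ 2 * q)).
    by rewrite !ler_pM2l.
  have b5 : tau * (tau * `|d ^+ 2 * q|) <= tau * `|d ^+ 2 * q|.
    by rewrite ler_pM2l// ler_piMl.
  rewrite /A /t (_ : _ + _ = l + tau * (2 * d * b) + tau * (tau * (d ^+ 2 * q))); last by ring.
  lra.
have Km : 0 < K + t * m.
  have b1 : - `|d * m| <= d * m by rewrite lerNl -normrN ler_norm.
  have b2 : tau * - `|d * m| <= tau * (d * m) by rewrite ler_pM2l.
  rewrite /t -mulrA; lra.
pose s := Num.sqrt (l / A).
have lA : 0 < l / A by rewrite divr_gt0.
have s0 : 0 < s by rewrite sqrtr_gt0.
have sA : s ^+ 2 * A = l by rewrite sqr_sqrtr ?divfK ?gt_eqF// ltW.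
have := h t s s0 sA => hK.
have {hK} : (s * (K + t * m)) ^+ 2 <= K ^+ 2.
  by rewrite ler_sqr ?nnegrE ?(ltW K0)// mulr_ge0// ltW.
rewrite exprMn -(ler_pM2r A0) mulrAC sA => key.
have : 2 * K * (tau * d ^+ 2) <= tau * P * (tau * d ^+ 2).
  have PP : K ^+ 2 * q - l * m ^+ 2 <= P by exact: ler_norm.
  have td0 : 0 <= tau * d ^+ 2 * tau by apply: mulr_ge0; [apply: mulr_ge0|]; exact: ltW.
  have := ler_wpM2l td0 PP.
  have : 2 * K * (tau * d ^+ 2) <= tau * d ^+ 2 * tau * (K ^+ 2 * q - l * m ^+ 2).
    rewrite -subr_ge0; move: key; rewrite -subr_ge0.
    set X := (X in 0 <= X -> _) ; set Y := (X in _ -> 0 <= X).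
    suff -> : X = Y by [].
    by rewrite /X /Y /A /t /d; ring.
  move=> q1 q2; apply: (le_trans (le_trans q1 q2)).
  by rewrite (_ : tau * d ^+ 2 * tau * P = tau * P * (tau * d ^+ 2))//; ring.
have td : 0 < tau * d ^+ 2 by rewrite mulr_gt0.
by rewrite (ler_pM2r td) => /le_lt_trans/(_ s3); rewrite ltxx.
Qed.

Variables (N : nat) (a : nat -> R).
Hypothesis a_ge0 : forall k : nat, (1 <= k <= N)%N -> 0 <= a k.
Local Notation F := (nonlinearity N a).

(** Weak derivatives, L and I only depend on the class of the function
    modulo null sets. *)
Lemma ae_eq_maximizer c l (phi psi : R -> R) : {ae mu, forall x, phi x = psi x} ->
  measurable_fun setT psi ->
  constrained_maximizer N a c l phi -> constrained_maximizer N a c l psi.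
Proof.
move=> e mpsi [H2 Lphi maxphi].
have w1 := in_H_weak_derivative H2 (isT : (1 <= 2)%N).
have w2 := in_H_weak_derivative H2 (isT : (2 <= 2)%N).
have mphi : measurable_fun setT phi by case: w1 => /in_L2_measurable.
have w1' := ae_eq_is_weak_derivative e mpsi w1.
have w2' := ae_eq_is_weak_derivative e mpsi w2.
split; first exact: in_H2_intro w1' w2'.
  rewrite -Lphi (L_functionalE c w1' w2') (L_functionalE c w1 w2).
  have m (u : R -> R) : measurable_fun setT u -> measurable_fun setT
      (energy_density c u (weak_derivative 1 phi) (weak_derivative 2 phi)
                        u (weak_derivative 1 phi) (weak_derivative 2 phi)).
    move=> mfu; apply: measurable_funD; last exact: measurable_funM.
    have m1 : measurable_fun setT (weak_derivative 1 phi).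
      by case: w1 => _ /in_L2_measurable.
    have m2 : measurable_fun setT (weak_derivative 2 phi).
      by case: w2 => _ /in_L2_measurable.
    by apply: measurable_funB; apply: measurable_funM => //; exact: measurable_funM.
  apply: ae_eq_Rintegral => //; [exact: m|exact: m|].
  by apply: aeS e => x ex; rewrite /energy_density ex.
move=> u hu Lu; rewrite (_ : I_functional N a psi = I_functional N a phi); first exact: maxphi.
have mG (u' : R -> R) : measurable_fun setT u' ->
    measurable_fun setT (fun x => G N a (`|u' x| ^+ 2)).
  move=> mfu; under eq_fun do rewrite G_sqr.
  by apply: measurable_funM; [exact: measurable_sum_powers|exact: measurable_funX].
by apply/esym/ae_eq_Rintegral => //; [exact: mG|exact: mG|apply: aeS e => x ->].
Qed.

Lemma euler_lagrange c l B (psi psi1 v2 : R -> R) : 0 < l ->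
  constrained_maximizer N a c l psi ->
  is_weak_derivative 1 psi psi1 -> is_weak_derivative 2 psi v2 ->
  (forall x, `|psi x| <= B) ->
  let K := \int[mu]_x (F (psi x ^+ 2) * psi x * psi x) in
  0 < K -> forall eta, test_function eta ->
  l * \int[mu]_x (F (psi x ^+ 2) * psi x * eta x) =
  K * \int[mu]_x energy_density c psi psi1 v2
        eta (derive1n 1 eta) (derive1n 2 eta) x.
Proof.
move=> l0 [_ Lpsi maxpsi] h1 h2 psiB K K0 eta te.
have e1 := test_function_weak_derivative 1 te.
have e2 := test_function_weak_derivative 2 te.
have psi2 : in_L2 psi by case: h1.
have eta2 : in_L2 eta by case: e1.
have [Be hBe] : exists Be, forall x, `|eta x| <= Be.
  have [M M0 hM] := test_function_support te.
  have [Be hBe] := continuous_itv_bounded (- M) M (test_function_continuous te).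
  exists (Num.max Be 0) => x; rewrite le_max.
  have [xM|xM] := boolP (- M <= x <= M); first by rewrite hBe.
  by rewrite hM// normr0 lexx orbT.
have f2 := nonlinearity_in_L2 N a psi2 psiB.
have ifpsi := in_L2_integrableM f2 psi2.
have ifeta := in_L2_integrableM f2 eta2.
apply: (lagrange_multiplier (q := L_functional c eta)) => // t s s0.
rewrite -Lpsi -(L_functional_line c s t h1 h2 e1 e2) => Lu.
pose u x := s * (psi x + t * eta x).
have w1 := is_weak_derivativeZ s (is_weak_derivativeD h1 (is_weak_derivativeZ t e1)).
have w2 := is_weak_derivativeZ s (is_weak_derivativeD h2 (is_weak_derivativeZ t e2)).
have u2 : in_L2 u by case: w1.
have uB x : `|u x| <= s * (B + `|t| * Be).
  rewrite /u normrM gtr0_norm// ler_pM2l// (le_trans (ler_normD _ _))// lerD//.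
  by rewrite normrM ler_wpM2l.
have Iu : I_functional N a u <= I_functional N a psi.
  by apply: maxpsi; [exact: in_H2_intro w1 w2|rewrite Lu Lpsi].
have := le_trans (I_functional_tangent a_ge0 u2 uB psi2 psiB) Iu.
rewrite gerDl pmulr_rle0//.
suff -> : \int[mu]_x (F (psi x ^+ 2) * psi x * (u x - psi x)) =
   s * (K + t * \int[mu]_x (F (psi x ^+ 2) * psi x * eta x)) - K by rewrite subr_le0.
have Z k (f : R -> R) : mu.-integrable setT (EFin \o f) ->
    mu.-integrable setT (EFin \o (fun x => k * f x)).
  exact: integrableZl.
rewrite /K -(RintegralZl t measurableT ifeta).
rewrite -(RintegralD measurableT ifpsi (Z _ _ ifeta)).
rewrite -(RintegralZl s measurableT (integrableD measurableT ifpsi (Z _ _ ifeta))).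
rewrite -(RintegralB measurableT (Z s _ (integrableD measurableT ifpsi (Z _ _ ifeta))) ifpsi).
by apply: eq_Rintegral => x _; rewrite /u; ring.
Qed.

End WeakEquation.

(** * Decay for the perturbed damped oscillators *)

Section Decay.
Context {R : realType}.
Implicit Types f df psi g : R -> R.

Lemma gronwall_le f df (k X x : R) : has_derivative f df ->
  (forall t, X <= t -> df t <= k * f t) -> X <= x ->
  f x <= f X * expR (k * (x - X)).
Proof.
move=> hf h Xx.
have hd := has_derivativeM hf (has_derivative_expR (- k)).
have := @has_derivative_nonincreasing _ _ _ X X x hd.
move=> /(_ _ (lexx X) Xx) H.
have {}H : f x * expR (- k * x) <= f X * expR (- k * X).
  apply: H => t Xt; rewrite (_ : _ + _ = (df t - k * f t) * expR (- k * t)); last by ring.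
  by rewrite mulr_le0_ge0 ?expR_ge0// subr_le0 h.
rewrite -(ler_pM2r (expR_gt0 (- k * x))) (le_trans H)// -mulrA -expRD.
by rewrite (_ : k * (x - X) + - k * x = - k * X)//; ring.
Qed.

Lemma le0_of_expR_bound (d k K X : R) : 0 < k ->
  (forall y, X <= y -> d <= K * expR (- k * y)) -> d <= 0.
Proof.
move=> k0 h; rewrite leNgt; apply/negP => d0.
have K0 : 0 < K.
  have := lt_le_trans d0 (h X (lexx X)).
  by rewrite pmulr_lgt0// expR_gt0.
pose y := Num.max X (K / d / k).
have := h y; rewrite le_max lexx => /(_ isT).
rewrite mulNr expRN ler_pdivlMr ?expR_gt0// leNgt => /negP; apply.
rewrite mulrC -ltr_pdivrMr//.
apply: lt_le_trans (expR_ge1Dx _).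
rewrite (@le_lt_trans _ _ (k * y))// ?ltrDr//.
by rewrite [k * y]mulrC -ler_pdivrMr// le_max lexx orbT.
Qed.

(** Otherwise [f] would grow like [expR (k * x)]. *)
Lemma unstable_bounded_le0 f df (k K X x : R) : 0 < k -> has_derivative f df ->
  (forall t, X <= t -> k * f t <= df t) -> (forall t, X <= t -> f t <= K) ->
  X <= x -> f x <= 0.
Proof.
move=> k0 hf h hK Xx.
have hd := has_derivativeM hf (has_derivative_expR (- k)).
suff : f x * expR (- k * x) <= 0 by rewrite pmulr_lle0// expR_gt0.
apply: (le0_of_expR_bound (K := K) (X := x) k0) => y xy.
apply: (@le_trans _ _ (f y * expR (- k * y))); last first.
  by rewrite ler_wpM2r ?expR_ge0// hK// (le_trans Xx).
apply: (has_derivative_nondecreasing hd) Xx xy => t Xt.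
rewrite (_ : _ + _ = (df t - k * f t) * expR (- k * t)); last by ring.
by rewrite mulr_ge0 ?expR_ge0// subr_ge0 h.
Qed.

(** The weight [e] is spent differently at each use: to absorb the forcing into
    the energy, or to trade decay of one factor against the other. *)
Lemma young (e a b : R) : 0 < e -> `|2 * a * b| <= e * a ^+ 2 + b ^+ 2 / e.
Proof.
move=> e0; rewrite -(ler_pM2l e0).
have -> : e * (e * a ^+ 2 + b ^+ 2 / e) = (e * a) ^+ 2 + b ^+ 2.
  by field; rewrite gt_eqF.
rewrite -{1}(gtr0_norm e0) -normrM ler_norml.
have := sqr_ge0 (e * a - b); have := sqr_ge0 (e * a + b).
by rewrite !expr2; lra.
Qed.

Lemma norm_le_of_sqr (t K a x : R) : t ^+ 2 <= K * expR (- (2 * a) * x) ->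
  `|t| <= (K + 1) * expR (- a * x).
Proof.
move=> h; have K0 : 0 <= K.
  have := le_trans (sqr_ge0 t) h; by rewrite pmulr_lge0// expR_gt0.
rewrite -ler_sqr ?nnegrE ?normr_ge0//; last by rewrite mulr_ge0 ?expR_ge0 ?addr_ge0.
rewrite real_normK ?num_real// (le_trans h)// exprMn -expRM_natl.
rewrite (_ : 2%:R * (- a * x) = - (2 * a) * x); last by ring.
rewrite ler_wpM2r ?expR_ge0//.
have := sqr_ge0 K; rewrite !expr2; lra.
Qed.

Section Oscillator.
Variables (a : R) (psi p1 p2 p3 g : R -> R).
Hypothesis a_gt0 : 0 < a.
Let b2 := 1 - a ^+ 2.
Hypothesis b2_gt0 : 0 < b2.
Hypothesis hpsi : has_derivative psi p1.
Hypothesis hp1 : has_derivative p1 p2.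
Hypothesis hp2 : has_derivative p2 p3.
Hypothesis hp3 : has_derivative p3
  (fun x => - (2 - 4 * a ^+ 2) * p2 x - psi x + g x).

Let z x := p2 x - 2 * a * p1 x + psi x.
Let A x := p3 x - 2 * a * p2 x + p1 x + a * z x.
Let Q x := p1 x - a * psi x.
Let Ez x := A x ^+ 2 + b2 * z x ^+ 2.
Let Ep x := Q x ^+ 2 + b2 * psi x ^+ 2.

(** The weight [b2] is the one for which the energy decays exactly at the rate
    [2 * a]: in terms of w = e^(a x) z the equation reads w'' + b2 w = e^(a x) g, and
    [Ez] is e^(- 2 a x) times the energy of this undamped oscillator. *)
Lemma stable_energy_derivative :
  has_derivative Ez (fun x => - (2 * a) * Ez x + 2 * A x * g x).
Proof.
have hz : has_derivative z (fun x => p3 x - 2 * a * p2 x + p1 x).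
  exact: has_derivativeD (has_derivativeB hp2 (has_derivativeZ _ hp1)) hpsi.
have hA := has_derivativeD (has_derivativeD
  (has_derivativeB hp3 (has_derivativeZ (2 * a) hp2)) hp1) (has_derivativeZ a hz).
apply: has_derivative_ext (has_derivativeD (has_derivative_sqr hA)
  (has_derivativeZ b2 (has_derivative_sqr hz))) _ => x.
by rewrite /Ez /A /z /b2; ring.
Qed.

(** The mirror image of [stable_energy_derivative], with growth instead of
    decay and [z] as forcing. *)
Lemma unstable_energy_derivative :
  has_derivative Ep (fun x => 2 * a * Ep x + 2 * Q x * z x).
Proof.
have hQ : has_derivative Q (fun x => p2 x - a * p1 x).
  exact: has_derivativeB hp1 (has_derivativeZ _ hpsi).
apply: has_derivative_ext (has_derivativeD (has_derivative_sqr hQ)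
  (has_derivativeZ b2 (has_derivative_sqr hpsi))) _ => x.
by rewrite /Ep /Q /z /b2; ring.
Qed.

Let Ez_ge0 x : 0 <= Ez x.
Proof. by rewrite addr_ge0 ?sqr_ge0// mulr_ge0 ?sqr_ge0// ltW. Qed.

Let Ep_ge0 x : 0 <= Ep x.
Proof. by rewrite addr_ge0 ?sqr_ge0// mulr_ge0 ?sqr_ge0// ltW. Qed.

Let A_le x : A x ^+ 2 <= Ez x.
Proof. by rewrite /Ez lerDl mulr_ge0 ?sqr_ge0// ltW. Qed.

Let Q_le x : Q x ^+ 2 <= Ep x.
Proof. by rewrite /Ep lerDl mulr_ge0 ?sqr_ge0// ltW. Qed.

Let z_le x : z x ^+ 2 <= Ez x / b2.
Proof. by rewrite ler_pdivlMr// mulrC /Ez lerDr sqr_ge0. Qed.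

Let psi_le x : psi x ^+ 2 <= Ep x / b2.
Proof. by rewrite ler_pdivlMr// mulrC /Ep lerDr sqr_ge0. Qed.

Lemma unstable_energy_growth x : a * Ep x - Ez x / (a * b2) <= 2 * a * Ep x + 2 * Q x * z x.
Proof.
have := young (Q x) (z x) a_gt0; rewrite ler_norml => /andP[h _].
have h1 : a * Q x ^+ 2 <= a * Ep x by rewrite ler_wpM2l// ltW.
have h2 : z x ^+ 2 / a <= Ez x / (a * b2).
  by rewrite invfM mulrA [leRHS]mulrAC ler_pM2r ?invr_gt0.
lra.
Qed.

Variables M B : R.
Hypothesis g_le : forall x, `|g x| <= M * `|psi x| ^+ 3.
Hypothesis psi_bounded : forall x, 0 <= x -> `|psi x| <= B.
Hypothesis p1_bounded : forall x, 0 <= x -> `|p1 x| <= B.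
Hypothesis psi_cvg0 : forall e, 0 < e -> exists2 X, 0 <= X &
  forall x, X <= x -> `|psi x| <= e.

Let Ep_bounded x : 0 <= x -> Ep x <= ((1 + a) * B) ^+ 2 + b2 * B ^+ 2.
Proof.
move=> x0; have B0 := le_trans (normr_ge0 _) (psi_bounded x0).
have sq (t u : R) : 0 <= u -> `|t| <= u -> t ^+ 2 <= u ^+ 2.
  by move=> u0 tu; rewrite -real_normK ?num_real// ler_sqr ?nnegrE.
apply: lerD; last first.
  by apply: ler_wpM2l; [exact: ltW|exact: sq (psi_bounded x0)].
apply: sq; first by rewrite mulr_ge0// addr_ge0// ltW.
apply: le_trans (ler_normB _ _) _; rewrite mulrDl mul1r.
apply: lerD; first exact: p1_bounded.
by rewrite normrM gtr0_norm// ler_pM2l// psi_bounded.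
Qed.

(** Far out the cubic forcing satisfies g^2 <= d^2 b2 psi^2 with [d] as small as
    desired.  Then [D] = [Ep] - k [Ez] satisfies D' >= (a / 2) D, so boundedness of
    [Ep] forces D <= 0; the energy [Ez] now drives itself and decays at least at
    the rate [a], half of the rate it has without forcing. *)
Lemma psi_sqr_decay : exists C, forall x, 0 <= x -> psi x ^+ 2 <= C * expR (- a * x).
Proof.
have ab2 : 0 < a * b2 by rewrite mulr_gt0.
(* In D = Ep - k Ez, this k makes the forcing Ez / (a b2) of Ep equal to a k Ez,
   one half of what the decay of k Ez contributes. *)
pose k := (a ^+ 2 * b2)^-1.
have k0 : 0 < k by rewrite invr_gt0 mulr_gt0// exprn_gt0.
pose d := a / (2 * (1 + k)).
have d0 : 0 < d by rewrite divr_gt0// mulr_gt0// addr_gt0.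
have dk : (1 + k) * d = a / 2 by rewrite /d; field; rewrite gt_eqF// addr_gt0.
(* Below the size e, the cubic bound on g gives g^2 <= d^2 b2 psi^2. *)
have [e e0 he] : exists2 e : R, 0 < e & M ^+ 2 * e ^+ 4 <= d ^+ 2 * b2.
  have q0 : 0 < d ^+ 2 * b2 / (M ^+ 2 + 1).
    apply: divr_gt0; first by rewrite mulr_gt0// exprn_gt0.
    by rewrite ltr_wpDl// sqr_ge0.
  exists (Num.min 1 (d ^+ 2 * b2 / (M ^+ 2 + 1))); first by rewrite lt_min ltr01.
  set e := Num.min _ _.
  have e_le1 : e <= 1 by rewrite ge_min lexx.
  have e_ge0 : 0 <= e.
    by rewrite le_min ler01 ltW.
  have : e <= d ^+ 2 * b2 / (M ^+ 2 + 1) by rewrite ge_min lexx orbT.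
  rewrite ler_pdivlMr; last by rewrite ltr_wpDl// sqr_ge0.
  apply: le_trans; rewrite mulrDr mulr1 (@le_trans _ _ (e * M ^+ 2)) ?lerDl//.
  rewrite mulrC ler_wpM2r ?sqr_ge0//.
  by rewrite exprS ler_piMr// exprn_ile1.
have [X X0 hX] := psi_cvg0 e0.
have g2 x : X <= x -> g x ^+ 2 <= d ^+ 2 * b2 * psi x ^+ 2.
  move=> /hX px; rewrite -real_normK ?num_real//.
  have M0 : `|g x| <= `|M| * `|psi x| ^+ 3.
    by rewrite (le_trans (g_le x))// ler_wpM2r ?exprn_ge0// ler_norm.
  have : `|g x| ^+ 2 <= (`|M| * `|psi x| ^+ 3) ^+ 2.
    by rewrite ler_sqr ?nnegrE ?mulr_ge0 ?exprn_ge0.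
  move=> /le_trans; apply; rewrite exprMn real_normK ?num_real// -exprM.
  rewrite (exprD _ 4 2) mulrA real_normK ?num_real// ler_wpM2r ?sqr_ge0//.
  rewrite (le_trans _ he)// ler_wpM2l ?sqr_ge0//.
  by rewrite lerXn2r ?nnegrE// ltW.
have Ag x : X <= x -> 2 * A x * g x <= d * (Ez x + Ep x).
  move=> Xx; have := young (A x) (g x) d0; rewrite ler_norml => /andP[_ h].
  apply: le_trans h _; rewrite mulrDr lerD//; first by rewrite ler_wpM2l ?A_le// ltW.
  rewrite ler_pdivrMr// (le_trans (g2 x Xx))//.
  rewrite (_ : d * Ep x * d = d ^+ 2 * Ep x); last by ring.
  rewrite -mulrA ler_wpM2l ?sqr_ge0//.
  by rewrite mulrC -ler_pdivlMr.
pose D x := Ep x - k * Ez x.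
have hD := has_derivativeB unstable_energy_derivative (has_derivativeZ k stable_energy_derivative).
have D_le0 x : X <= x -> D x <= 0.
  apply: (unstable_bounded_le0 (k := a / 2)) hD _ _; first by rewrite divr_gt0.
    move=> t Xt; have h1 := unstable_energy_growth t; have h2 := Ag t Xt.
    have kA : k * (2 * A t * g t) <= k * (d * (Ez t + Ep t)).
      by rewrite ler_wpM2l// ltW.
    have kE : Ez t / (a * b2) = a * (k * Ez t).
      by rewrite /k; field; rewrite gt_eqF// gt_eqF.
    have kd : k * d <= a / 2 by rewrite -dk mulrDl mul1r lerDr ltW.
    have da : d <= a / 2 by rewrite -dk mulrDl mul1r lerDl mulr_ge0// ltW.
    have t1 : k * d * Ep t <= a / 2 * Ep t by rewrite ler_wpM2r.
    have t2 : d * (k * Ez t) <= a / 2 * (k * Ez t) by rewrite ler_wpM2r// mulr_ge0// ltW.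
    have t3 : 0 <= a * (k * Ez t) by rewrite !mulr_ge0// ltW.
    move: h1 kA t1 t2 t3; rewrite kE /D; lra.
  move=> t Xt; apply: le_trans (Ep_bounded (le_trans X0 Xt)).
  by rewrite /D gerBl mulr_ge0// ltW.
have Ez_le x : X <= x -> Ez x <= Ez X * expR (- a * (x - X)).
  apply: (gronwall_le stable_energy_derivative) => t Xt.
  have := Ag t Xt; have := D_le0 t Xt; rewrite /D subr_le0 => Dt.
  have : d * Ep t <= d * (k * Ez t) by rewrite ler_wpM2l// ltW.
  have : (1 + k) * d * Ez t = a / 2 * Ez t by rewrite dk.
  have : 0 <= a * Ez t by rewrite mulr_ge0// ltW.
  lra.
have B2 : 0 <= B ^+ 2 by exact: sqr_ge0.
exists (B ^+ 2 * expR (a * X) + k * Ez X * expR (a * X) / b2) => x x0.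
have [xX|Xx] := leP x X.
  rewrite (@le_trans _ _ (B ^+ 2 * expR (a * X) * expR (- a * x)))//.
    rewrite (@le_trans _ _ (B ^+ 2))//.
      have := psi_bounded x0; rewrite -[_ ^+ 2]real_normK ?num_real// => pB.
      by rewrite ler_sqr ?nnegrE// (le_trans _ pB).
    rewrite -mulrA ler_peMr// -expRD -expR0 ler_expR mulNr -mulrBr.
    by rewrite mulr_ge0 ?subr_ge0// ltW.
  rewrite ler_wpM2r ?expR_ge0// lerDl; apply: divr_ge0; last exact: ltW.
  by rewrite mulr_ge0 ?expR_ge0// mulr_ge0// ltW.
rewrite (le_trans (psi_le x))//.
rewrite (@le_trans _ _ (k * Ez X * expR (a * X) / b2 * expR (- a * x)))//; last first.
  by rewrite ler_wpM2r ?expR_ge0// lerDr mulr_ge0// expR_ge0.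
rewrite [leRHS]mulrAC ler_pM2r ?invr_gt0//.
have := D_le0 x (ltW Xx); rewrite /D subr_le0 => /le_trans; apply.
rewrite -!mulrA ler_wpM2l ?(ltW k0)// -expRD.
apply: le_trans (Ez_le x (ltW Xx)) _; rewrite ler_wpM2l// ler_expR; lra.
Qed.

(** By [psi_sqr_decay], [g] decays at the rate 3 a / 2.  Therefore H, which
    is e^(2 a x) [Ez] up to a constant, satisfies H' <= e^(- a x / 2) H with an
    integrable coefficient, and stays bounded. *)
Lemma stable_energy_decay : exists2 C, 0 <= C &
  forall x, 0 <= x -> Ez x <= C * expR (- (2 * a) * x).
Proof.
have [C hC] := psi_sqr_decay.
have C0 : 0 <= C.
  by have := le_trans (sqr_ge0 _) (hC 0 (lexx 0)); rewrite mulr0 expR0 mulr1.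
pose M3 := M ^+ 2 * C ^+ 3.
have M30 : 0 <= M3 by rewrite mulr_ge0 ?sqr_ge0// exprn_ge0.
have g2 x : 0 <= x -> g x ^+ 2 <= M3 * expR (- (3 * a) * x).
  move=> x0; have M0 : `|g x| <= `|M| * `|psi x| ^+ 3.
    by rewrite (le_trans (g_le x))// ler_wpM2r ?exprn_ge0// ler_norm.
  have : `|g x| ^+ 2 <= (`|M| * `|psi x| ^+ 3) ^+ 2.
    by rewrite ler_sqr ?nnegrE ?mulr_ge0 ?exprn_ge0.
  rewrite real_normK ?num_real// => /le_trans; apply.
  rewrite exprMn real_normK ?num_real// -exprM mulnC exprM.
  rewrite real_normK ?num_real// /M3 -mulrA ler_wpM2l ?sqr_ge0//.
  rewrite (_ : - (3 * a) * x = 3%:R * (- a * x)); last by ring.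
  rewrite expRM_natl -exprMn lerXn2r ?nnegrE ?sqr_ge0//; last exact: hC.
  by rewrite mulr_ge0// expR_ge0.
pose H x := Ez x * expR (2 * a * x) + M3.
have hH := has_derivativeD
  (has_derivativeM stable_energy_derivative (has_derivative_expR (2 * a)))
  (has_derivative_cst M3).
(* An integrating factor for the coefficient e^(- a x / 2); on x >= 0 it lies
   between 1 and e^(2 / a). *)
have hw : has_derivative (fun x => expR (2 / a * expR (- (a / 2) * x)))
   (fun x => - expR (- (a / 2) * x) * expR (2 / a * expR (- (a / 2) * x))).
  move=> x; have h := has_derivative_expR (- (a / 2)) x.
  have := @is_derive1_comp R _ _ x _ _ (has_derivative_expR (2 / a) _) h.
  move=> /is_derive_eq; apply.
  by field; rewrite gt_eqF.
have hHw := has_derivativeM hH hw.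
exists ((Ez 0 + M3) * expR (2 / a)).
  by rewrite mulr_ge0 ?expR_ge0// addr_ge0.
move=> x x0.
have := has_derivative_nonincreasing hHw (X := 0) _ (lexx 0) x0.
rewrite !mulr0 !expR0 !mulr1 => K.
have {}K : H x * expR (2 / a * expR (- (a / 2) * x)) <= (Ez 0 + M3) * expR (2 / a).
  apply: K => t t0; set w := expR (2 / a * _); set E := expR (- (a / 2) * t).
  have E0 : 0 < E by exact: expR_gt0.
  have w0 : 0 <= w by exact: expR_ge0.
  set F := expR (2 * a * t).
  have F0 : 0 < F by exact: expR_gt0.
  rewrite -/(H t) -/F.
  rewrite (_ : _ + _ = w * (2 * A t * g t * F - E * (Ez t * F + M3))); last by rewrite /H -/F; ring.
  rewrite mulr_ge0_le0// subr_le0.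
  (* The weight E = e^(- a t / 2) balances the two terms of the forcing. *)
  have := young (A t) (g t) E0; rewrite ler_norml => /andP[_ y].
  have FE : F * expR (- (3 * a) * t) = E ^+ 2.
    by rewrite -expRM_natl -expRD; congr expR; field.
  have gF : g t ^+ 2 / E * F <= E * M3.
    rewrite mulrAC ler_pdivrMr// (@le_trans _ _ (M3 * expR (- (3 * a) * t) * F))//.
      by rewrite ler_pM2r// g2.
    by rewrite -mulrA [_ * F]mulrC FE expr2; lra.
  have AE : E * A t ^+ 2 * F <= E * Ez t * F by rewrite ler_pM2r// ler_pM2l.
  have : 2 * A t * g t * F <= (E * A t ^+ 2 + g t ^+ 2 / E) * F by rewrite ler_pM2r.
  lra.
have w1 : 1 <= expR (2 / a * expR (- (a / 2) * x)).
  by rewrite -expR0 ler_expR mulr_ge0 ?expR_ge0// divr_ge0// ltW.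
rewrite -(ler_pM2r (expR_gt0 (2 * a * x))) -[leRHS]mulrA -[X in _ <= _ * X]expRD.
rewrite (_ : - (2 * a) * x + 2 * a * x = 0) ?expR0 ?mulr1; last by ring.
apply: le_trans K.
have H0 : 0 <= H x by rewrite addr_ge0// mulr_ge0// expR_ge0.
apply: (@le_trans _ _ (H x)); first by rewrite /H lerDl.
by rewrite ler_peMr.
Qed.

(** The difference of [Ep] and a large multiple of e^(- 2 a x) grows at least at
    the rate [a] but is bounded above, hence it is nonpositive. *)
Lemma unstable_energy_decay : exists2 C, 0 <= C &
  forall x, 0 <= x -> Ep x <= C * expR (- (2 * a) * x).
Proof.
have [C C0 hC] := stable_energy_decay.
have ab2 : 0 < a * b2 by rewrite mulr_gt0.
pose C' := C / (a * b2) / a.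
have C'0 : 0 <= C' by rewrite /C'; do 2 (apply: divr_ge0; last exact: ltW).
exists C' => // x x0; rewrite -subr_le0.
have hE : has_derivative (fun x => C' * expR (- (2 * a) * x))
    (fun x => C' * (- (2 * a) * expR (- (2 * a) * x))).
  exact: has_derivativeZ (has_derivative_expR _).
apply: (unstable_bounded_le0 a_gt0 (has_derivativeB unstable_energy_derivative hE)) x0.
  move=> t t0; have := unstable_energy_growth t.
  have : Ez t / (a * b2) <= a * C' * expR (- (2 * a) * t).
    rewrite ler_pdivrMr// (le_trans (hC t t0))//.
    rewrite (_ : a * C' = C / (a * b2)); last by rewrite /C'; field; rewrite !gt_eqF.
    by rewrite mulrAC divfK ?gt_eqF.
  have : 0 <= a * C' * expR (- (2 * a) * t).
    by rewrite mulr_ge0 ?expR_ge0// mulr_ge0// ltW.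
  lra.
move=> t t0; apply: le_trans (Ep_bounded t0).
by rewrite gerBl mulr_ge0// expR_ge0.
Qed.

(** The two energies control psi, psi' - a psi, z and z' + a z, from which
    psi and its first three derivatives are linear combinations. *)
Lemma decay_right : exists C, forall x, 0 <= x ->
  [/\ `|psi x| <= C * expR (- a * x), `|p1 x| <= C * expR (- a * x),
      `|p2 x| <= C * expR (- a * x) & `|p3 x| <= C * expR (- a * x)].
Proof.
have [Cz Cz0 hz] := stable_energy_decay; have [Cp Cp0 hp] := unstable_energy_decay.
pose E x := expR (- a * x).
have bnd (t c x : R) : t ^+ 2 <= c * expR (- (2 * a) * x) -> `|t| <= (c + 1) * E x.
  exact: norm_le_of_sqr.
have bdiv x c d : c <= d * expR (- (2 * a) * x) ->
    c / b2 <= d / b2 * expR (- (2 * a) * x).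
  by move=> h; rewrite mulrAC ler_pM2r ?invr_gt0.
pose K0 := Cp / b2 + 1; pose K1 := Cp + 1 + a * K0.
pose Kz := Cz / b2 + 1; pose K2 := Kz + 2 * a * K1 + K0.
pose K3 := Cz + 1 + a * Kz + 2 * a * K2 + K1.
have K0_ge0 : 0 <= K0 by rewrite addr_ge0// divr_ge0// ltW.
have Kz_ge0 : 0 <= Kz by rewrite addr_ge0// divr_ge0// ltW.
have a0 := ltW a_gt0.
have K1_ge0 : 0 <= K1 by have := mulr_ge0 a0 K0_ge0; rewrite /K1; lra.
have K2_ge0 : 0 <= K2 by have := mulr_ge0 a0 K1_ge0; rewrite /K2; lra.
have K3_ge0 : 0 <= K3.
  by have := mulr_ge0 a0 Kz_ge0; have := mulr_ge0 a0 K2_ge0; rewrite /K3; lra.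
exists (K0 + K1 + K2 + K3) => x x0; rewrite -/(E x).
have E0 : 0 <= E x by exact: expR_ge0.
have le_norm (t u v w' : R) : `|t| <= u -> `|v| <= w' -> `|t + v| <= u + w'.
  by move=> tu vw; rewrite (le_trans (ler_normD _ _))// lerD.
have nZ (k t u : R) : 0 <= k -> `|t| <= u * E x -> `|k * t| <= k * u * E x.
  by move=> k0 tu; rewrite normrM ger0_norm// -mulrA ler_wpM2l.
have h0 : `|psi x| <= K0 * E x by apply/bnd/(le_trans (psi_le x))/bdiv/hp.
have hQ : `|Q x| <= (Cp + 1) * E x by apply/bnd/(le_trans (Q_le x))/hp.
have hZ : `|z x| <= Kz * E x by apply/bnd/(le_trans (z_le x))/bdiv/hz.
have hA : `|A x| <= (Cz + 1) * E x by apply/bnd/(le_trans (A_le x))/hz.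
have h1 : `|p1 x| <= K1 * E x.
  rewrite (_ : p1 x = Q x + a * psi x); last by rewrite /Q; ring.
  rewrite (_ : K1 * E x = (Cp + 1) * E x + a * K0 * E x); last by rewrite /K1; ring.
  by apply: (le_norm) => //; exact: nZ.
have h2 : `|p2 x| <= K2 * E x.
  rewrite (_ : p2 x = z x + 2 * a * p1 x + - psi x); last by rewrite /z; ring.
  rewrite (_ : K2 * E x = Kz * E x + 2 * a * K1 * E x + K0 * E x); last first.
    by rewrite /K2; ring.
  apply: (le_norm); last by rewrite normrN.
  by apply: (le_norm) => //; apply: (nZ) => //; rewrite mulr_ge0.
have h3 : `|p3 x| <= K3 * E x.
  rewrite (_ : p3 x = A x + - (a * z x) + 2 * a * p2 x + - p1 x); last by rewrite /A; ring.
  rewrite (_ : K3 * E x = (Cz + 1) * E x + a * Kz * E x + 2 * a * K2 * E x + K1 * E x); last first.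
    by rewrite /K3; ring.
  apply: (le_norm); last by rewrite normrN.
  apply: (le_norm); last by apply: (nZ) => //; rewrite mulr_ge0.
  by apply: (le_norm) => //; rewrite normrN; exact: nZ.
by split; [apply: le_trans h0 _|apply: le_trans h1 _|apply: le_trans h2 _
  |apply: le_trans h3 _]; rewrite ler_wpM2r//; lra.
Qed.

End Oscillator.

Lemma decay (a M B : R) (psi p1 p2 p3 g : R -> R) : 0 < a -> 0 < 1 - a ^+ 2 ->
  has_derivative psi p1 -> has_derivative p1 p2 -> has_derivative p2 p3 ->
  has_derivative p3 (fun x => - (2 - 4 * a ^+ 2) * p2 x - psi x + g x) ->
  (forall x, `|g x| <= M * `|psi x| ^+ 3) ->
  (forall x, `|psi x| <= B) -> (forall x, `|p1 x| <= B) ->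
  (forall e, 0 < e -> exists2 X, 0 <= X & forall x, X <= `|x| -> `|psi x| <= e) ->
  exists C, forall x,
  [/\ `|psi x| <= C * expR (- (a * `|x|)), `|p1 x| <= C * expR (- (a * `|x|)),
      `|p2 x| <= C * expR (- (a * `|x|)) & `|p3 x| <= C * expR (- (a * `|x|))].
Proof.
move=> a0 b0 h0 h1 h2 h3 gle psiB p1B psi0.
have [C1 hC1] : exists C, forall x, 0 <= x ->
  [/\ `|psi x| <= C * expR (- a * x), `|p1 x| <= C * expR (- a * x),
      `|p2 x| <= C * expR (- a * x) & `|p3 x| <= C * expR (- a * x)].
  apply: (decay_right a0 b0 h0 h1 h2 h3 gle (fun x _ => psiB x) (fun x _ => p1B x)).
  move=> e /psi0[X X0 hX]; exists X => // x Xx; apply: hX.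
  by rewrite (le_trans Xx)// ler_norm.
have [C2 hC2] : exists C, forall x, 0 <= x ->
  [/\ `|psi (- x)| <= C * expR (- a * x), `|- p1 (- x)| <= C * expR (- a * x),
      `|p2 (- x)| <= C * expR (- a * x) & `|- p3 (- x)| <= C * expR (- a * x)].
  apply: (@decay_right a (fun x => psi (- x)) (fun x => - p1 (- x))
    (fun x => p2 (- x)) (fun x => - p3 (- x)) (fun x => g (- x)) a0 b0 _ _ _ _ M B).
  - exact: has_derivative_reflect.
  - have := has_derivative_reflect h1 => /(has_derivativeZ (-1)) h x.
    have := h x; rewrite mulrNN mul1r; under eq_fun do rewrite mulN1r; exact.
  - exact: has_derivative_reflect.
  - have := has_derivative_reflect h3 => /(has_derivativeZ (-1)) h x.
    have := h x; rewrite mulrNN mul1r; under eq_fun do rewrite mulN1r; exact.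
  - by move=> x; exact: gle.
  - by move=> x _; exact: psiB.
  - by move=> x _; rewrite normrN; exact: p1B.
  - move=> e /psi0[X X0 hX]; exists X => // x Xx; apply: hX.
    by rewrite normrN (le_trans Xx)// ler_norm.
exists (Num.max C1 C2) => x; have [x0|x0] := leP 0 x.
  rewrite (ger0_norm x0) -mulNr; have [] := hC1 x x0.
  by move=> q0 q1 q2 q3; split; [apply: le_trans q0 _|apply: le_trans q1 _
    |apply: le_trans q2 _|apply: le_trans q3 _];
    rewrite ler_wpM2r ?expR_ge0// le_max lexx.
have nx0 : 0 <= - x by rewrite oppr_ge0 ltW.
rewrite (ltr0_norm x0) -mulNr; have [] := hC2 (- x) nx0.
rewrite !opprK !normrN.
by move=> q0 q1 q2 q3; split; [apply: le_trans q0 _|apply: le_trans q1 _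
  |apply: le_trans q2 _|apply: le_trans q3 _];
  rewrite ler_wpM2r ?expR_ge0// le_max lexx orbT.
Qed.

End Decay.

(** * From the weak equation to the decay of every derivative *)

Section Regularity.
Context {R : realType}.
Local Notation mu := (@lebesgue_measure R).
Implicit Types u v w psi eta f g : R -> R.
Local Notation locint := (locally_integrable [set: R]).

(** With S a double primitive of psi - g, integrating by parts turns the weak
    equation into: v2 + c^2 psi + S has zero second weak derivative, so it is
    affine.  Thus [v2] is as regular as [psi] and S, and the fourth order equation
    follows by differentiating twice. *)
Lemma weak_solution_regular (c C : R) (psi psi1 v2 g : R -> R) :
  has_derivative psi psi1 -> continuous psi1 -> locint v2 ->
  (forall x, psi1 x = C + primitive v2 x) -> continuous g ->
  (forall eta, test_function eta ->
    \int[mu]_x energy_density c psi psi1 v2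
                 eta (derive1n 1 eta) (derive1n 2 eta) x =
    \int[mu]_x (g x * eta x)) ->
  exists p2 p3, [/\ {ae mu, forall x, v2 x = p2 x}, has_derivative psi1 p2,
    has_derivative p2 p3 &
    has_derivative p3 (fun x => - c ^+ 2 * p2 x - psi x + g x)].
Proof.
move=> hpsi cpsi1 lv2 psi1E cg weak.
have cpsi := has_derivative_continuous hpsi.
pose r x := psi x - g x.
have cr : continuous r by move=> x; apply: cvgB; [exact: cpsi|exact: cg].
have hQ := primitive_derivative cr; set Q := primitive r in hQ.
have cQ := has_derivative_continuous hQ.
have hS := primitive_derivative cQ; set S := primitive Q in hS.
have cS := has_derivative_continuous hS.
have cT : continuous (fun x => c ^+ 2 * psi x + S x).
  by move=> x; apply: cvgD; [apply: cvgMr; exact: cpsi|exact: cS].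
have lpsi := continuous_locint cpsi; have lpsi1 := continuous_locint cpsi1.
have lS := continuous_locint cS; have lg := continuous_locint cg.
have Z k (f : R -> R) : mu.-integrable setT (EFin \o f) ->
    mu.-integrable setT (EFin \o (fun x => k * f x)).
  exact: integrableZl.
have [A [B0 hAB]] : exists A B, {ae mu, forall x,
    v2 x + (c ^+ 2 * psi x + S x) = A + B * x}.
  apply: affine_of_weak; first by apply: locintD => //; exact: continuous_locint.
  move=> eta te; have te1 := test_function_derive1 te.
  have te2 := test_function_derive1n 2 te.
  have iv2 := pairing_integrable lv2 te2.
  have ipsi2 := pairing_integrable lpsi te2.
  have iS2 := pairing_integrable lS te2.
  have ipsi1 := pairing_integrable lpsi1 te1.
  have ipsi := pairing_integrable lpsi te.
  have ig := pairing_integrable lg te.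
  have b1 := by_parts hpsi cpsi1 te1.
  have b2 := by_parts hS cQ te1.
  have b3 := by_parts hQ cr te.
  have e0 : \int[mu]_x (r x * eta x) =
      \int[mu]_x (psi x * eta x) - \int[mu]_x (g x * eta x).
    rewrite -(RintegralB measurableT ipsi ig).
    by apply: eq_Rintegral => x _; rewrite /r mulrBl.
  have e1 := weak eta te.
  have e2 : \int[mu]_x energy_density c psi psi1 v2
      eta (derive1n 1 eta) (derive1n 2 eta) x =
    \int[mu]_x (v2 x * derive1n 2 eta x)
    - c ^+ 2 * \int[mu]_x (psi1 x * derive1 eta x) + \int[mu]_x (psi x * eta x).
    rewrite -(RintegralZl (c ^+ 2) measurableT ipsi1).
    rewrite -(RintegralB measurableT iv2 (Z _ _ ipsi1)).
    by rewrite -(RintegralD measurableT (integrableB measurableT iv2 (Z _ _ ipsi1)) ipsi).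
  have -> : \int[mu]_x ((v2 x + (c ^+ 2 * psi x + S x)) * derive1n 2 eta x) =
    \int[mu]_x (v2 x * derive1n 2 eta x)
    + c ^+ 2 * \int[mu]_x (psi x * derive1n 2 eta x)
    + \int[mu]_x (S x * derive1n 2 eta x).
    rewrite -(RintegralZl (c ^+ 2) measurableT ipsi2).
    rewrite -(RintegralD measurableT iv2 (Z _ _ ipsi2)).
    rewrite -(RintegralD measurableT (integrableD measurableT iv2 (Z _ _ ipsi2)) iS2).
    by apply: eq_Rintegral => x _; ring.
  rewrite derive1nS derive1n1 b1 b2 b3 e0.
  move: e1; rewrite e2 derive1nS derive1n1 => <-.
  move: (Rintegral _ _ _) (Rintegral _ _ _) (Rintegral _ _ _) => V P X.
  by ring.
pose p2 x := A + B0 * x - (c ^+ 2 * psi x + S x).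
have hp2 : has_derivative p2 (fun x => B0 - (c ^+ 2 * psi1 x + Q x)).
  apply: has_derivative_ext (has_derivativeB (has_derivativeD (has_derivative_cst A)
    (has_derivativeZ B0 (@has_derivative_id R)))
    (has_derivativeD (has_derivativeZ (c ^+ 2) hpsi) hS)) _ => x.
  by rewrite add0r mulr1.
have cp2 := has_derivative_continuous hp2.
have v2p2 : {ae mu, forall x, v2 x = p2 x}.
  by apply: aeS hAB => x; rewrite /p2 => <-; rewrite addrK.
have hpsi1 : has_derivative psi1 p2.
  have -> : psi1 = (fun x => C + primitive p2 x).
    apply/funext => x; rewrite psi1E; congr (_ + _).
    have mv2 := locint_measurable lv2.
    have mp2 := continuous_measurable_fun cp2.
    by rewrite /primitive; congr (_ - _); apply: ae_eq_Rintegral.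
  apply: has_derivative_ext (has_derivativeD (has_derivative_cst C)
    (primitive_derivative cp2)) _ => x.
  by rewrite add0r.
exists p2, (fun x => B0 - (c ^+ 2 * psi1 x + Q x)).
split; [exact: v2p2|exact: hpsi1|exact: hp2|].
apply: has_derivative_ext (has_derivativeB (has_derivative_cst B0)
  (has_derivativeD (has_derivativeZ (c ^+ 2) hpsi1) hQ)) _ => x.
by rewrite /r; ring.
Qed.

Definition exp_decay (al : R) (f : R -> R) : Prop :=
  exists C, forall x, `|f x| <= C * expR (- (al * `|x|)).

Section ExpDecay.
Variable al : R.
Hypothesis al0 : 0 <= al.

Lemma exp_decayD f g : exp_decay al f -> exp_decay al g ->
  exp_decay al (fun x => f x + g x).
Proof.
move=> [C hC] [D hD]; exists (C + D) => x.
by rewrite (le_trans (ler_normD _ _))// mulrDl lerD.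
Qed.

Lemma exp_decayZ k f : exp_decay al f -> exp_decay al (fun x => k * f x).
Proof.
move=> [C hC]; exists (`|k| * C) => x.
by rewrite normrM -mulrA ler_wpM2l.
Qed.

(** The weight is at most 1, so its square is at most itself. *)
Lemma exp_decayM f g : exp_decay al f -> exp_decay al g ->
  exp_decay al (fun x => f x * g x).
Proof.
move=> [C hC] [D hD]; exists (C * D) => x.
have E0 := expR_ge0 (- (al * `|x|)).
have E1 : expR (- (al * `|x|)) <= 1 by rewrite expR_le1 oppr_le0 mulr_ge0.
have C0 : 0 <= C * expR (- (al * `|x|)) by exact: le_trans (hC x).
have D0 : 0 <= D.
  have := le_trans (normr_ge0 _) (hD 0).
  by rewrite normr0 mulr0 oppr0 expR0 mulr1.
rewrite normrM (le_trans (ler_pM _ _ (hC x) (hD x)))//.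
rewrite mulrCA [leRHS]mulrAC [leRHS]mulrC ler_wpM2l//.
by rewrite ler_piMr.
Qed.

Local Notation regular_decay := (regular (exp_decay al)).

Lemma regular_decayD n f g : regular_decay n f -> regular_decay n g ->
  regular_decay n (fun x => f x + g x).
Proof. exact: regularD exp_decayD _ _ _. Qed.

Lemma regular_decayZ n k f : regular_decay n f -> regular_decay n (fun x => k * f x).
Proof. exact: (regularZ exp_decayZ). Qed.

Lemma regular_decayM n f g : regular_decay n f -> regular_decay n g ->
  regular_decay n (fun x => f x * g x).
Proof. exact: (regularM exp_decayD exp_decayM). Qed.

Lemma regular_decay_pow n f k : regular_decay n f -> regular_decay n (fun x => f x ^+ k.+1).
Proof.
move=> rf; elim: k => [|k IH]; first by under eq_fun do rewrite expr1.
by under eq_fun do rewrite exprS; exact: regular_decayM.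
Qed.

Lemma regular_decay_sum n (I : Type) (s : seq I) (fs : I -> R -> R) f :
  regular_decay n f -> (forall i, regular_decay n (fs i)) ->
  regular_decay n (fun x => \sum_(i <- s) fs i x).
Proof.
move=> rf rfs; elim: s => [|i s IH].
  have -> : (fun x => \sum_(i <- [::]) fs i x) = (fun x => 0 * f x).
    by apply/funext => x; rewrite big_nil mul0r.
  exact: regular_decayZ.
have -> : (fun x => \sum_(i <- i :: s) fs i x) =
    (fun x => fs i x + \sum_(i <- s) fs i x).
  by apply/funext => x; rewrite big_cons.
exact: regular_decayD.
Qed.

(** The fourth derivative is expressed by [psi], [p2] and [d], and so inherits
    any number of derivatives that they have: one more order for [psi] and [p2]. *)
Lemma regular_decay_bootstrap (b2 b0 : R) (psi p1 p2 p3 : R -> R) (d : R -> R) :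
  has_derivative psi p1 -> has_derivative p1 p2 -> has_derivative p2 p3 ->
  has_derivative p3 (fun x => b2 * p2 x + b0 * psi x + d x) ->
  exp_decay al psi -> exp_decay al p1 -> exp_decay al p2 -> exp_decay al p3 ->
  (forall n, regular_decay n psi -> regular_decay n d) ->
  forall n, regular_decay n psi.
Proof.
move=> h0 h1 h2 h3 d0 d1 d2 d3 hd.
suff H n : regular_decay n psi /\ regular_decay n p2 by move=> n; case: (H n).
elim: n => [|n [rpsi rp2]]; first by [].
have rp4 : regular_decay n (fun x => b2 * p2 x + b0 * psi x + d x).
  by apply: regular_decayD (hd _ rpsi); apply: regular_decayD; exact: regular_decayZ.
have rp3 : regular_decay n.+1 p3 by split => //; exists (fun x => b2 * p2 x + b0 * psi x + d x).
have rp2' : regular_decay n.+1 p2.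
  by split => //; exists p3 => //; exact: regularW.
split => //; split => //; exists p1 => //.
case: n {rpsi rp2 rp4 rp3} rp2' => [|n] rp2'; first by [].
by split => //; exists p2 => //; exact/regularW/regularW.
Qed.

End ExpDecay.

(** The sum F starts at k = 1, which gives the factor psi^2. *)
Lemma nonlinearity_cubic (N : nat) (a : nat -> R) (psi : R -> R) (B k : R) :
  (forall x, `|psi x| <= B) -> exists M, forall x,
  `|k * (nonlinearity N a (psi x ^+ 2) * psi x)| <= M * `|psi x| ^+ 3.
Proof.
move=> psiB.
have [K hK] := sum_powers_bounded a (fun k => 2 * k.-1)%N (index_iota 1 N.+1) psiB.
exists (`|k| * K) => x.
have -> : nonlinearity N a (psi x ^+ 2) =
    (\sum_(k <- index_iota 1 N.+1) a k * psi x ^+ (2 * k.-1)) * psi x ^+ 2.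
  rewrite nonlinearity_sqr mulr_suml !big_nat; apply: eq_bigr => -[//|j] _.
  by rewrite -mulrA -exprD /= mulnS addnC.
rewrite -[_ * psi x ^+ 2 * _]mulrA -exprSr mulrA normrM normrM normrX.
by rewrite ler_wpM2r ?exprn_ge0// ler_wpM2l.
Qed.

End Regularity.

Unset Implicit Arguments.

Theorem theorem3 (R : realType) (N : nat) (a : nat -> R) (c lambda0 : R)
    (phi : R -> R)
    (a_ge0 : forall k : nat, (1 <= k <= N)%N -> 0 <= a k)
    (a_neq0 : exists k : nat, (1 <= k <= N)%N /\ a k != 0)
    (c_gt0 : 0 < c) (c_lt : c < Num.sqrt 2) (lambda0_gt0 : 0 < lambda0)
    (phi_max : constrained_maximizer N a c lambda0 phi) :
  exists psi : R -> R,
    [/\ smooth psi,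
        {ae @lebesgue_measure R, forall x, phi x = psi x} &
        forall j : nat, exists C : R, forall x : R,
          `|derive1n j psi x| <= C * expR (- (Num.sqrt (2 - c ^+ 2) / 2 * `|x|))].
Proof.
have phiH2 : in_H 2 phi by case: phi_max.
have [psi [psi1 [v2 [C [hpsi phipsi w1 w2 psi1E]]]]] := H2_representative phiH2.
have psi2 : in_L2 psi by case: w1.
have psi12 : in_L2 psi1 by case: w1.
have lv2 : locally_integrable [set: R] v2 by case: w2 => _ /in_L2_locint.
have cpsi := has_derivative_continuous hpsi.
have cpsi1 : continuous psi1.
  rewrite (funext psi1E) => x.
  by apply: cvgD; [exact: cvg_cst|exact: primitive_continuous].
have [[B psiB] psi0] := H1_vanishing hpsi cpsi1 psi2 psi12.
have psi_max := ae_eq_maximizer phipsi (in_L2_measurable psi2) phi_max.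
pose F := nonlinearity N a.
pose K := \int[@lebesgue_measure R]_x (F (psi x ^+ 2) * psi x * psi x).
have f2 := nonlinearity_in_L2 N a psi2 psiB.
have F_ge0 x : 0 <= F (psi x ^+ 2) by rewrite nonlinearity_ge0// sqr_ge0.
have fpsi_ge0 x : 0 <= F (psi x ^+ 2) * psi x * psi x.
  by rewrite -mulrA -expr2 mulr_ge0// sqr_ge0.
set al := Num.sqrt (2 - c ^+ 2) / 2.
have c2 : c ^+ 2 < 2.
  by rewrite -[ltRHS](@sqr_sqrtr R)// ltr_sqr ?nnegrE ?sqrtr_ge0// ltW.
have al2 : al ^+ 2 = (2 - c ^+ 2) / 4.
  rewrite /al expr_div_n sqr_sqrtr; first by congr (_ / _); rewrite expr2 -natrM.
  by rewrite subr_ge0 ltW.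
have al0 : 0 < al by rewrite divr_gt0// sqrtr_gt0 subr_gt0.
(* K is nonnegative.  If it vanishes, so does its nonnegative integrand, and phi = 0
   almost everywhere. *)
have [K0|K0] := ltP 0 K; last first.
  have psi_zero : {ae @lebesgue_measure R, forall x, psi x = 0}.
    have ifpsi := in_L2_integrableM f2 psi2.
    have e0 : (\int[@lebesgue_measure R]_x
        `|(F (psi x ^+ 2) * psi x * psi x)%:E| = 0)%E.
      under eq_integral => x _ do rewrite gee0_abs ?lee_fin//.
      rewrite -(fineK (integrable_fin_num measurableT ifpsi)).
      congr EFin; apply/le_anti/andP; split; first exact: K0.
      exact: Rintegral_ge0.
    have := (ae_eq_integral_abs _ measurableT (measurable_int _ ifpsi)).1 e0.
    apply: aeS => x /(_ I)/= -[].
    rewrite -mulrA -expr2 => /eqP; rewrite mulf_eq0 sqrf_eq0.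
    case/orP => [|/eqP//]; rewrite /F /nonlinearity big_nat psumr_eq0; last first.
      move=> k hk; apply: mulr_ge0; first exact: a_ge0.
      exact/exprn_ge0/sqr_ge0.
    have [k [hk ak]] := a_neq0 => /allP/(_ k).
    rewrite mem_index_iota ltnS hk => /(_ isT)/=.
    by rewrite mulf_eq0 (negbTE ak)/= expf_eq0 sqrf_eq0 => /andP[_ /eqP].
  have h0 n : derive1n n (fun=> 0 : R) = (fun=> 0 : R).
    elim: n => [//|n IH]; rewrite derive1nS IH.
    exact: has_derivativeE (has_derivative_cst 0).
  exists (fun=> 0); split.
  - by move=> n x; rewrite h0; exact: derivable_cst.
  - by apply: aeS (aeI phipsi psi_zero) => x [-> ->].
  - by move=> j; exists 0 => x; rewrite h0 normr0 mul0r.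
have EL := euler_lagrange a_ge0 lambda0_gt0 psi_max w1 w2 psiB K0.
pose g x := lambda0 / K * (F (psi x ^+ 2) * psi x).
have cg : continuous g.
  have cF : continuous (fun x => F (psi x ^+ 2)).
    rewrite (funext (nonlinearity_sqr N a psi)).
    elim: (index_iota _ _) => [|k s IH].
      by under eq_fun do rewrite big_nil; exact: cst_continuous.
    under eq_fun do rewrite big_cons.
    move=> x; apply: cvgD; last exact: IH.
    apply: cvgMr; exact: (continuous_comp (cpsi x) (@exprn_continuous R _ (psi x))).
  by move=> x; apply: cvgMr; apply: cvgM; [exact: cF|exact: cpsi].
have weak eta : test_function eta ->
    \int[@lebesgue_measure R]_x energy_density c psi psi1 v2
                 eta (derive1n 1 eta) (derive1n 2 eta) x =
    \int[@lebesgue_measure R]_x (g x * eta x).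
  move=> te; have ifeta := in_L2_integrableM f2 (test_function_in_L2 te).
  transitivity (lambda0 / K *
      \int[@lebesgue_measure R]_x (F (psi x ^+ 2) * psi x * eta x)).
    by rewrite mulrAC EL// mulrC mulKf// gt_eqF.
  rewrite -(RintegralZl (lambda0 / K) measurableT ifeta).
  by apply: eq_Rintegral => x _; rewrite /g -!mulrA.
have [p2 [p3 [v2p2 hp1 hp2 hp3]]] :=
  weak_solution_regular hpsi cpsi1 lv2 psi1E cg weak.
have cp2 := has_derivative_continuous hp2.
have p22 : in_L2 p2.
  apply: ae_eq_in_L2 v2p2 (continuous_measurable_fun cp2) _.
  by case: w2.
have [[B1 p1B] _] := H1_vanishing hp1 cp2 psi12 p22.
have [M gM] := @nonlinearity_cubic R N a psi B (lambda0 / K) psiB.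
have b2 : 0 < 1 - al ^+ 2 by rewrite al2; have := sqr_ge0 c; lra.
have [D hD] : exists D, forall x,
  [/\ `|psi x| <= D * expR (- (al * `|x|)), `|psi1 x| <= D * expR (- (al * `|x|)),
      `|p2 x| <= D * expR (- (al * `|x|)) & `|p3 x| <= D * expR (- (al * `|x|))].
  apply: (@decay R al M (Num.max B B1) psi psi1 p2 p3 g) => //.
  - apply: has_derivative_ext hp3 _ => x.
    by rewrite al2 (_ : 2 - 4 * _ = c ^+ 2)//; field.
  - by move=> x; rewrite le_max psiB.
  - by move=> x; rewrite le_max p1B orbT.
have reg n : regular (exp_decay al) n psi.
  apply: (regular_decay_bootstrap (b2 := - c ^+ 2) (b0 := -1) (d := g) hpsi hp1 hp2).
  - by apply: has_derivative_ext hp3 _ => x; rewrite mulN1r.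
  - by exists D => x; case: (hD x).
  - by exists D => x; case: (hD x).
  - by exists D => x; case: (hD x).
  - by exists D => x; case: (hD x).
  - move=> m rpsi; apply: regular_decayZ; apply: (regular_decayM (ltW al0)) => //.
    rewrite (funext (nonlinearity_sqr N a psi)).
    (* Only the powers psi^(2 k) with k >= 1 occur; index 0 is given the value 0 to
       have a family of decaying functions on all of nat. *)
    pose pw k := fun x => if k is j.+1 then a k * psi x ^+ (2 * j).+1.+1 else 0 * psi x.
    rewrite (_ : (fun x => _) =
        (fun x => \sum_(k <- index_iota 1 N.+1) pw k x)); last first.
      apply/funext => x; rewrite !big_nat; apply: eq_bigr => -[//|k] _.
      by rewrite /pw mulnS.
    apply: (@regular_decay_sum R al m nat _ pw psi) => // -[|k]; apply: regular_decayZ => //.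
    exact: (regular_decay_pow (ltW al0)).
exists psi; split => //; first exact: regular_smooth reg.
move=> j; have := reg (j + 0)%N => /regular_derive1n[[Cj hCj] _].
by exists Cj.
Qed.
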